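(* Let $G=\langle a_1,\ldots,a_n,s_1,\ldots,s_k \mid s_1^{n_1}=1,\ldots,s_k^{n_k}=1\rangle\cong F_n*\mathbb{Z}_{n_1}*\cdots*\mathbb{Z}_{n_k}$, where $n_1,\ldots,n_k$ are positive integers, $\mathbb{Z}_{n_i}$ is the cyclic group of order $n_i$, and $F_n=\langle a_1,\ldots,a_n\rangle\le G$ is the free group of rank $n$. If $v\in F_n$ generates a measure free factor of $F_n$ (i.e. $\langle v\rangle$ is a measure free factor of $F_n$), then $w=v s_1^{p_1}\cdots s_k^{p_k}$ generates a measure free factor of $G$ (i.e. $\langle w\rangle$ is a measure free factor of $G$) for any integers $p_1,\ldots,p_k$.
   Context: A standard Borel space is a measurable space isomorphic to a Borel subset of the interval with its Borel $\sigma$-algebra. A Borel action $G\curvearrowright X$ of a group on a standard Borel probability space $(X,\mu)$ is p.m.p. if $G$ acts by $\mu$-preserving Borel automorphisms, and it is free if the set of $x\in X$ with $g\cdot x=x$ for some non-trivial $g\in G$ has measure zero. For a subgroup $H\le G$, $E_H^X$ denotes the equivalence relation on $X$ whose classes are the $H$-orbits. A Borel equivalence relation on $X$ is an equivalence relation that is a Borel subset of $X\times X$. It is measure preserving if it is generated by a family of measure preserving Borel isomorphisms between Borel subsets of $X$, i.e. it is the smallest Borel equivalence relation containing all pairs $(x,\varphi(x))$ with $\varphi$ in the family and $x$ in the domain of $\varphi$. Two Borel equivalence relations $E_1,E_2$ on a standard Borel space are orthogonal, written $E_1\perp E_2$, if for every cycle $(x_i)_{i\in\mathbb{Z}_{2n}}$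 of points with $(x_i,x_{i+1})\in E_1$ for all odd $i$ and $(x_i,x_{i+1})\in E_2$ for all even $i$, one has $x_i=x_{i+1}$ for some $i$. A measure preserving Borel equivalence relation $E$ is the free product of Borel sub-equivalence relations $E_1,E_2$, written $E=E_1*E_2$, if $E$ is generated by $E_1\cup E_2$ and there is a full measure set $B$ such that $E_1|_B\perp E_2|_B$, where $E_i|_B=E_i\cap(B\times B)$. A subgroup $H\le G$ is a measure free factor of $G$ if there exist a free p.m.p. Borel action $G\curvearrowright X$ on a standard Borel probability space and a Borel equivalence relation $E'$ on $X$ such that $E_G^X=E_H^X*E'$.
   Formalization: The theorem is stated for nontrivial v only: for v = 1 the claim fails in general, e.g. in Z_2 * Z_2 with w = s_1 s_2, since the trivial group is a measure free factor of F_n but ⟨s_1 s_2⟩ is not one of G. *)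

(* Defs.v *)
From HB Require Import structures.
From mathcomp Require Import all_boot all_order all_algebra.
From mathcomp Require Import all_classical all_reals all_analysis.

Set Implicit Arguments.
Unset Strict Implicit.
Unset Printing Implicit Defensive.

Import Order.TTheory GRing.Theory Num.Theory.

Local Open Scope classical_set_scope.

(* Groups are MathComp [groupType]s (possibly infinite); a subgroup is a set
   of elements of the ambient group. *)

Definition subgroup (G : groupType) (H : set G) : Prop :=
  group_closed [in H].

Definition subgroup_gen (G : groupType) (A : set G) : set G :=
  smallest (@subgroup G) A.

Definition zexpg (G : groupType) (x : G) (z : int) : G :=
  match z with
  | Posz i => (x ^+ i)%g
  | Negz i => (x ^- i.+1)%g
  end.

(* The letter (x, false) stands for the generator x, (x, true) for its
   formal inverse. *)
Definition word (S : Type) := seq (S * bool).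

Definition eval_word (S : Type) (G : groupType) (f : S -> G) (w : word S) : G :=
  (\prod_(l <- w) (if l.2 then (f l.1)^-1 else f l.1))%g.

(* The congruence on words whose quotient is the group < S | rels >. *)
Inductive word_equiv (S : Type) (rels : set (word S)) :
    word S -> word S -> Prop :=
| word_equiv_refl w : word_equiv rels w w
| word_equiv_sym w1 w2 : word_equiv rels w1 w2 -> word_equiv rels w2 w1
| word_equiv_trans w1 w2 w3 :
    word_equiv rels w1 w2 -> word_equiv rels w2 w3 -> word_equiv rels w1 w3
| word_equiv_cancel u v x b :
    word_equiv rels (u ++ (x, b) :: (x, ~~ b) :: v) (u ++ v)
| word_equiv_rel u v r :
    rels r -> word_equiv rels (u ++ r ++ v) (u ++ v).

(* G = < S | rels >, the generator x being interpreted as f x: evaluation of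
   words induces a bijection from the quotient by [word_equiv] onto G. *)
Definition has_presentation (S : Type) (rels : set (word S))
    (G : groupType) (f : S -> G) : Prop :=
  (forall g, exists w, eval_word f w = g) /\
  (forall w1 w2, eval_word f w1 = eval_word f w2 <-> word_equiv rels w1 w2).

(* On the generators a_1, ..., a_n (left), s_1, ..., s_k (right), the
   relators s_j ^ (ord j). *)
Definition cyclic_relators (n k : nat) (ord : 'I_k -> nat) :
    set (word ('I_n + 'I_k)) :=
  [set w | exists j, w = nseq (ord j) (inr j, false)].
Arguments cyclic_relators n {k} ord.

Definition sum_fun (S T U : Type) (f : S -> U) (g : T -> U) (x : S + T) : U :=
  match x with inl i => f i | inr j => g j end.

(* Partial maps between measurable spaces are represented by total functions,
   whose values outside A are irrelevant. *)
Definition borel_iso d1 d2 (T1 : measurableType d1) (T2 : measurableType d2)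
    (A : set T1) (B : set T2) (f : T1 -> T2) : Prop :=
  [/\ measurable A, measurable B, set_bij A B f, measurable_fun A f &
      forall C, measurable C -> C `<=` A -> measurable (f @` C)].

Definition standard_borel (R : realType) d (T : measurableType d) : Prop :=
  exists (B : set R) (f : T -> R),
    B `<=` `[0%R, 1%R] /\ borel_iso [set: T] B f.

Definition mp_borel_iso (R : realType) d (T : measurableType d)
    (mu : probability T R) (A B : set T) (f : T -> T) : Prop :=
  borel_iso A B f /\
  (forall C, measurable C -> C `<=` A -> mu (f @` C) = mu C).

(* An action of the subgroup K of G is a function on G of which only the
   values at elements of K matter. *)
Definition pmp_action (R : realType) d (T : measurableType d)
    (mu : probability T R) (G : groupType) (K : set G) (act : G -> T -> T) :
    Prop :=
  [/\ forall x, act 1%g x = x,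
      forall g h x, K g -> K h -> act (g * h)%g x = act g (act h x) &
      forall g, K g -> mp_borel_iso mu [set: T] [set: T] (act g)].

Definition free_action (R : realType) d (T : measurableType d)
    (mu : probability T R) (G : groupType) (K : set G) (act : G -> T -> T) :
    Prop :=
  mu.-negligible [set x | exists g, [/\ K g, g <> 1%g & act g x = x]].

Definition orbit_rel (T : Type) (G : groupType) (act : G -> T -> T)
    (H : set G) : set (T * T) :=
  [set xy | exists2 g, H g & act g xy.1 = xy.2].

Definition borel_equivalence d (T : measurableType d) (E : set (T * T)) :
    Prop :=
  [/\ measurable E,
      forall x, E (x, x),
      forall x y, E (x, y) -> E (y, x) &
      forall x y z, E (x, y) -> E (y, z) -> E (x, z)].

(* E is the smallest Borel equivalence relation containing S. *)
Definition generates d (T : measurableType d) (S E : set (T * T)) : Prop :=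
  [/\ borel_equivalence E, S `<=` E &
      forall E', borel_equivalence E' -> S `<=` E' -> E `<=` E'].

(* A family of partial isomorphisms is a set of pairs (domain, map). *)
Definition mp_equivalence (R : realType) d (T : measurableType d)
    (mu : probability T R) (E : set (T * T)) : Prop :=
  exists F : set (set T * (T -> T)),
    (forall A phi, F (A, phi) -> mp_borel_iso mu A (phi @` A) phi) /\
    generates
      [set xy | exists A phi, [/\ F (A, phi), A xy.1 & xy.2 = phi xy.1]] E.

(* [ordS] is the successor modulo the size of the index type. *)
Definition orthogonal_rel (T : Type) (E1 E2 : set (T * T)) : Prop :=
  forall (n : nat) (x : 'I_n.*2 -> T), (0 < n)%N ->
    (forall i : 'I_n.*2, odd i -> E1 (x i, x (ordS i))) ->
    (forall i : 'I_n.*2, ~~ odd i -> E2 (x i, x (ordS i))) ->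
    exists i : 'I_n.*2, x i = x (ordS i).

Definition restrict_rel (T : Type) (B : set T) (E : set (T * T)) :
    set (T * T) :=
  E `&` (B `*` B).

Definition free_product_rel (R : realType) d (T : measurableType d)
    (mu : probability T R) (E E1 E2 : set (T * T)) : Prop :=
  [/\ mp_equivalence mu E,
      borel_equivalence E1,
      borel_equivalence E2,
      generates (E1 `|` E2) E &
      exists B, [/\ measurable B, mu B = 1%E &
                    orthogonal_rel (restrict_rel B E1) (restrict_rel B E2)]].

(* The subgroup H is a measure free factor of the group K, both being given
   as subgroups of an ambient group G. *)
Definition measure_free_factor (R : realType) (G : groupType) (K H : set G) :
    Prop :=
  [/\ subgroup K, subgroup H, H `<=` K &
    exists (d : measure_display) (X : measurableType d) (mu : probability X R)
           (act : G -> X -> X) (E' : set (X * X)),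
      [/\ standard_borel R X, pmp_action mu K act, free_action mu K act,
          borel_equivalence E' &
          free_product_rel mu (orbit_rel act K) (orbit_rel act H) E']].

(* Main.v *)
Require Import Defs.
From HB Require Import structures.
From mathcomp Require Import all_boot all_order all_algebra.
From mathcomp Require Import all_classical all_reals all_analysis.
From mathcomp Require Import measurable_realfun.
From mathcomp Require Import zify ring lra.

(** Write F for the free group on the a_i, S for the subgroup generated by the
    s_j, and t for the product of the powers of the s_j, so that w = v t.  The
    argument has an algebraic, a dynamical and a combinatorial part.

    Algebra.  G is the free product of F and S: every nontrivial alternating
    product moves the empty normal form ([free_pair_factor]).  Since free
    groups are torsion-free, <v> is infinite cyclic, <v> and S generate a free
    product, and so do <v t> and S, by a ping-pong argument on the normal forms
    ([free_pair_twist]).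

    Dynamics.  Let F act on X with E_F = E_<v> * E'.  Letting S act trivially
    on X extends this to an action of G ([extend_action]).  The diagonal action
    of G on the product of X with the Bernoulli space of coin sequences indexed
    by G x nat is measure preserving, and almost everywhere free because the
    shift is ([coin_shift_fix_null]).  The product is a standard Borel space
    ([standard_borel_prod_coins]).  On it let L be the pull-back of E' along
    F-orbits ([lift_rel]), and let C be generated by L and E_S
    ([complement_rel]).  Then E_w and C generate E_G: E_S and E_w give E_v,
    then E_v and L give E_F because E_v and E' do so on X
    ([complement_rel_generates]).

    Orthogonality.  On a G-invariant conull set where all the freeness holds,
    orthogonality is freeness of a pair of relations: no nontrivial reduced
    path closes up.  A merge-and-split argument gives associativity
    ([rfree_assoc]): if R1, R2 are free and R12, R3 are free, with R12
    containing R1 and R2, then R1 is free from the join of R2 and R3.  It is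
    used twice.  From E_v * L inside E_F, and from E_F * E_S, the relation
    L is free from the join of E_v and E_S.  This join contains E_w and E_S,
    which are free from each other; hence E_w is free from the join of E_S and
    L, which is C ([rfree_complement]). *)

Set Implicit Arguments.
Unset Strict Implicit.
Unset Printing Implicit Defensive.

Local Open Scope classical_set_scope.

(** * Reduced paths in families of relations *)

Section Paths.
Variables (I : eqType) (T : Type).
Implicit Types (R : I -> T -> T -> Prop) (c : option I) (x : T) (s : seq (I * T)).

(** A path from [x], given by the list of its steps: each step carries its
    colour and its endpoint.  The path is reduced: consecutive points differ,
    consecutive colours differ, and the first colour differs from [c]. *)
Fixpoint rpath R c x s : Prop :=
  if s is l :: s' then
    [/\ c <> Some l.1, R l.1 x l.2, x <> l.2 & rpath R (Some l.1) l.2 s']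
  else True.

(** The endpoint of a path starting at [x]. *)
Definition rend x s : T := last x (map snd s).

(** The colour of the last step, or [c] for the empty path. *)
Definition rlast c s : option I := last c (map (Some \o fst) s).

(** A family of relations is free when no nonempty reduced path is closed. *)
Definition rfree R : Prop :=
  forall x s, rpath R None x s -> rend x s = x -> s = [::].

Lemma rpath_cat R c x s1 s2 :
  rpath R c x (s1 ++ s2) <->
  rpath R c x s1 /\ rpath R (rlast c s1) (rend x s1) s2.
Proof.
elim: s1 c x => [|l s1 IH] c x /=; first by split=> [|[]].
split=> [[h1 h2 h3 /IH[h4 h5]]|[[h1 h2 h3 h4] h5]]; split=> //.
by apply/IH; split.
Qed.

Lemma rend_cat x s1 s2 : rend x (s1 ++ s2) = rend (rend x s1) s2.
Proof. by rewrite /rend map_cat last_cat. Qed.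

Lemma rpath_None R c x s : rpath R c x s -> rpath R None x s.
Proof. by case: s => //= l s []. Qed.

Lemma rpath_color R c d x s :
  (forall l s', s = l :: s' -> d <> Some l.1) ->
  rpath R c x s -> rpath R d x s.
Proof. by case: s => //= l s h [_ ? ? ?]; split=> //; exact: (h l s). Qed.

Lemma rpath_sub R R' c x s :
  (forall i y z, R i y z -> R' i y z) -> rpath R c x s -> rpath R' c x s.
Proof.
move=> sub; elim: s c x => //= l s IH c x [h1 h2 h3 h4].
by split; [| exact: sub| |exact: IH].
Qed.

Lemma rfree_sub R R' :
  (forall i y z, R i y z -> R' i y z) -> rfree R' -> rfree R.
Proof. by move=> sub fR' x s /(rpath_sub sub); exact: fR'. Qed.

End Paths.

(** Freeness is reflected by a map that carries steps to steps and does not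
    collapse them. *)
Lemma rfree_map (I : eqType) (T T' : Type) (f : T -> T')
    (R : I -> T -> T -> Prop) (R' : I -> T' -> T' -> Prop) :
  (forall i x y, R i x y -> x <> y -> R' i (f x) (f y) /\ f x <> f y) ->
  rfree R' -> rfree R.
Proof.
move=> RR' fR' x s ps es.
have : [seq (l.1, f l.2) | l <- s] = [::].
  apply: (fR' (f x)); last first.
    by rewrite -{2}es /rend -map_comp (_ : _ \o _ = f \o snd) // map_comp last_map.
  elim: s (x) (None : option I) ps {es} => //= l s IH y c [h1 h2 h3 /IH h4].
  by have [h5 h6] := RR' _ _ _ h2 h3; split.
by case: s {ps es}.
Qed.

(** A set of pairs as a binary predicate. *)
Definition rel_of (T : Type) (E : set (T * T)) (x y : T) : Prop := E (x, y).

(** [chain R m x y]: there is a path of [m] arbitrary [R]-steps from [x] to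
    [y]. *)
Inductive chain (T : Type) (R : T -> T -> Prop) : nat -> T -> T -> Prop :=
| chain0 x : chain R 0 x x
| chainS n x y z : R x y -> chain R n y z -> chain R n.+1 x z.

Section Chains.
Variables (T : Type) (E : T -> T -> Prop).

(** The reflexive and transitive closure. *)
Definition connected_by (x y : T) : Prop := exists n, chain E n x y.

Lemma connected_refl x : connected_by x x.
Proof. by exists 0; exact: chain0. Qed.

Lemma connected_step x y : E x y -> connected_by x y.
Proof. by move=> Exy; exists 1; apply: chainS Exy _; exact: chain0. Qed.

Lemma connected_trans x y z :
  connected_by x y -> connected_by y z -> connected_by x z.
Proof.
move=> [n ch] yz; elim: ch yz => // {n x y} n x y y' Exy _ IH /IH[m ch].
by exists m.+1; exact: chainS ch.
Qed.

Lemma connected_sym : (forall x y, E x y -> E y x) ->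
  forall x y, connected_by x y -> connected_by y x.
Proof.
move=> Esym x y [n ch]; elim: ch => {n x y} [x|n x y z Exy _ IH].
  exact: connected_refl.
by apply: connected_trans IH _; exact/connected_step/Esym.
Qed.

Lemma connected_min (E' : T -> T -> Prop) :
  (forall x, E' x x) -> (forall x y z, E' x y -> E' y z -> E' x z) ->
  (forall x y, E x y -> E' x y) -> forall x y, connected_by x y -> E' x y.
Proof.
move=> rE' tE' sub x y [n ch]; elim: ch => {n x y} // n x y z Exy _.
by apply: tE'; exact: sub.
Qed.

End Chains.

(** The join of the relations whose union is [E]. *)
Definition chain_closure (T : Type) (E : set (T * T)) : set (T * T) :=
  [set xy | connected_by (rel_of E) xy.1 xy.2].

Section Merge.
Variables (I J : eqType) (p : I -> J) (T : Type).
Variables (R : I -> T -> T -> Prop) (Q : J -> T -> T -> Prop).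

Lemma rpath_trans c j x s :
  (forall i x y, R i x y -> Q (p i) x y) ->
  (forall j x y z, Q j x y -> Q j y z -> Q j x z) ->
  rpath R c x s -> all (fun l => p l.1 == j) s -> s <> [::] ->
  Q j x (rend x s).
Proof.
move=> RQ Qtr; elim: s c x => [//|l s IH] c x /= [_ h2 _ h4] /andP[/eqP pj al] _.
have h : Q j x l.2 by rewrite -pj; exact: RQ.
case: s IH h4 al => [//|l' s] IH h4 al.
by apply: (Qtr _ _ l.2) => //; exact: (IH (Some l.1)).
Qed.

(** Merging colours along [p]: a family is free as soon as the families of
    colours in each fibre of [p] are free and some merged family [Q] of
    transitive relations is free. *)
Lemma rfree_merge :
  (forall i x y, R i x y -> Q (p i) x y) ->
  (forall j x y z, Q j x y -> Q j y z -> Q j x z) ->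
  (forall j x s, rpath R None x s -> all (fun l => p l.1 == j) s ->
     rend x s = x -> s = [::]) ->
  rfree Q -> rfree R.
Proof.
move=> RQ Qtr fib fQ.
(* The longest initial monochromatic block b, and the rest of the path once
   its blocks are merged. *)
have key s : forall c x, rpath R c x s -> s <> [::] ->
    exists j b s' t,
      [/\ s = b ++ s', b <> [::], all (fun l => p l.1 == j) b,
          rpath Q (Some j) (rend x b) t &
          rend (rend x b) t = rend x s].
  elim: s => [//|l s IH] c x /= [_ h2 h3 h4] _.
  case: s IH h4 => [|l' s] IH h4.
    by exists (p l.1), [:: l], [::], [::]; split=> //=; rewrite eqxx.
  have [//|//|j [b [s' [t [e b0 al pt et]]]]] := IH (Some l.1) l.2.
  have [plj|plj] := eqVneq (p l.1) j.
    by exists j, (l :: b), s', t; split=> //=; rewrite ?e // plj eqxx.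
  move: h4; rewrite e => h4.
  exists (p l.1), [:: l], (b ++ s'), ((j, rend l.2 b) :: t); split=> //=.
  - by rewrite eqxx.
  - split=> //=.
    + by move=> [] ep; rewrite ep eqxx in plj.
    + have [h _] := (rpath_cat _ _ _ _ _).1 h4; exact: (rpath_trans RQ Qtr h).
    + have [h _] := (rpath_cat _ _ _ _ _).1 h4.
      by move=> /esym/(fib _ _ _ (rpath_None h) al).
  - by rewrite -e; exact: et.
move=> x s ps es; apply: contrapT => s0.
have [j [b [s' [t [e b0 al pt et]]]]] := key s None x ps s0.
move: ps; rewrite e => /rpath_cat[pb _].
suff: (j, rend x b) :: t = [::] by [].
apply: (fQ x) => /=; last by rewrite -[RHS]es -et.
split=> //; first exact: (rpath_trans RQ Qtr pb).
by move=> /esym/(fib _ _ _ pb al).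
Qed.

Lemma rlast_all j c (l : I * T) s :
  all (fun l => p l.1 == j) (l :: s) ->
  exists i, p i = j /\ rlast c (l :: s) = Some i.
Proof.
elim: s c l => [|l' s IH] c l /=.
  by rewrite andbT => /eqP pl; exists l.1.
by move=> /andP[_]; exact: (IH (Some l.1)).
Qed.

(** A chain of steps with colours in a fibre of [p] can be reduced, by
    dropping the trivial steps and composing steps of the same colour. *)
Lemma chain_reduce j n x y :
  (forall i x y z, R i x y -> R i y z -> R i x z) ->
  chain (fun x y => exists2 i, p i = j & R i x y) n x y ->
  exists s, [/\ rpath R None x s, all (fun l => p l.1 == j) s & rend x s = y].
Proof.
move=> Rtr; elim=> {n x y} [x|n x y z [i pi Rxy] _ [s [ps al es]]].
  by exists [::].
have [exy|nxy] := pselect (x = y); first by exists s; rewrite exy.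
case: s ps al es => [|l s] ps al es.
  by exists [:: (i, y)]; split=> //=; rewrite pi eqxx.
move: ps al => /= [_ h2 h3 h4] /andP[pl al].
have [il|il] := eqVneq i l.1; last first.
  exists [:: (i, y), l & s]; split=> //=; last by rewrite pi eqxx pl.
  by split=> //; split=> // -[/eqP]; rewrite (negbTE il).
have [exl|nxl] := pselect (x = l.2).
  by exists s; split=> //; rewrite exl //; exact: rpath_None h4.
exists (l :: s); split=> //=; last by rewrite pl.
by split=> //; apply: Rtr h2; rewrite -il.
Qed.

(** Conversely, joining the relations of each fibre of [p] preserves
    freeness: each step of a join expands to a reduced path, and the expanded
    path is again reduced. *)
Lemma rfree_split :
  (forall i x y z, R i x y -> R i y z -> R i x z) ->
  rfree R ->
  rfree (fun j x y => exists n,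
    chain (fun x y => exists2 i, p i = j & R i x y) n x y).
Proof.
set Qc := (X in _ -> _ -> rfree X).
move=> Rtr fR.
have key t : forall c x, rpath Qc c x t -> exists s,
    [/\ rpath R None x s, rend x s = rend x t,
        forall l s', s = l :: s' -> c <> Some (p l.1) &
        s = [::] -> t = [::]].
  elim: t => [|[j y] t IH] c x /=; first by exists [::].
  move=> [cj [n ch] nxy pt].
  have [s [ps es hd s0]] := IH _ _ pt.
  have [b [pb al eb]] := chain_reduce Rtr ch.
  case: b pb al eb => [_ _ /= //|l b] pb al eb.
  exists ((l :: b) ++ s); split=> //.
  - apply/rpath_cat; split=> //; rewrite eb; apply: rpath_color ps => l' s' e.
    have [i [pi ->]] := rlast_all None al.
    by move=> [e2]; apply: (hd _ _ e); rewrite -e2 pi.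
  - by rewrite rend_cat eb es.
  - move=> l' s' [<- _]; move: al => /= /andP[/eqP -> _]; exact: cj.
move=> x t pt et; have [s [ps es _ s0]] := key t _ _ pt.
by apply: s0; apply: fR ps _; rewrite es.
Qed.

End Merge.

Lemma rpath_recolor (I I' : eqType) (T : Type) (P : pred I) (f : I -> I')
    (R : I -> T -> T -> Prop) (R' : I' -> T -> T -> Prop) x s :
  {in P &, injective f} ->
  (forall i y z, P i -> R i y z -> R' (f i) y z) ->
  rpath R None x s -> all (fun l => P l.1) s ->
  rpath R' None x [seq (f l.1, l.2) | l <- s].
Proof.
move=> finj RR'.
suff key c : (forall i, c = Some i -> P i) ->
    rpath R c x s -> all (fun l => P l.1) s ->
    rpath R' (omap f c) x [seq (f l.1, l.2) | l <- s] by exact: (key None).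
elim: s c x => //= l s IH c x cP [h1 h2 h3 h4] /andP[Pl al]; split=> //.
- case: c cP h1 {IH} => //= i /(_ i erefl) Pi h1 [fi].
  by apply: h1; congr Some; exact: finj.
- exact: RR'.
- by apply: (IH (Some l.1)) => // i [<-].
Qed.

(** The family of two relations, the first one having colour [true]. *)
Definition rel_pair (T : Type) (R1 R2 : T -> T -> Prop) (b : bool) :=
  if b then R1 else R2.

Lemma rfree_pairC (T : Type) (R1 R2 : T -> T -> Prop) :
  rfree (rel_pair R1 R2) -> rfree (rel_pair R2 R1).
Proof.
move=> fR x s ps es.
have := @rpath_recolor _ _ _ predT negb _ (rel_pair R1 R2) x s _ _ ps.
rewrite all_predT => /(_ _ _ isT)/fR h.
have : [seq (~~ l.1, l.2) | l <- s] = [::].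
  apply: h; last by rewrite /rend -map_comp.
  - by move=> ? ? _ _; exact: negb_inj.
  - by case.
by case: s {ps es h}.
Qed.

(** Associativity of free products of relations, in the form: if [R1], [R2]
    are free and [R12], [R3] are free, where [R12] contains [R1] and [R2], then
    [R1] is free from the join of [R2] and [R3].  The three relations together
    are free by merging the first two; then the last two are joined. *)
Lemma rfree_assoc (T : Type) (R1 R2 R3 R12 : T -> T -> Prop) :
  (forall x y, R1 x y -> R12 x y) -> (forall x y, R2 x y -> R12 x y) ->
  (forall x y z, R1 x y -> R1 y z -> R1 x z) ->
  (forall x y z, R2 x y -> R2 y z -> R2 x z) ->
  (forall x y z, R3 x y -> R3 y z -> R3 x z) ->
  (forall x y z, R12 x y -> R12 y z -> R12 x z) ->
  rfree (rel_pair R1 R2) -> rfree (rel_pair R12 R3) ->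
  rfree (rel_pair R1
    (fun x y => exists n, chain (fun x y => R2 x y \/ R3 x y) n x y)).
Proof.
move=> s1 s2 tr1 tr2 tr3 tr12 f12 f123.
(* The colours of R1, R2 and R3 are Some true, Some false and None. *)
pose R (i : option bool) := if i is Some b then rel_pair R1 R2 b else R3.
have fR : rfree R.
  apply: (@rfree_merge _ _ (isSome : option bool -> bool)) f123.
  - by case=> [[]|] //=.
  - by case.
  - case=> x s ps al es.
      have := @rpath_recolor _ _ _ isSome (odflt true) _ (rel_pair R1 R2) _ _
        _ _ ps.
      have -> : all (fun l => isSome l.1) s.
        by apply: sub_all al => l /=; case: l.1.
      move=> /(_ _ _ isT)/f12 h.
      have : [seq (odflt true l.1, l.2) | l <- s] = [::].
        apply: h; last by rewrite /rend -map_comp.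
        + by move=> [?|] // [?|] // _ _ /= ->.
        + by case.
      by case: s {ps es al h}.
    case: s ps al es => [//|[[?|] y] [|[[?|] z] s]] //=.
      by move=> [_ _ + _] _ e; rewrite /rend /= in e; rewrite e.
    by case=> _ _ _ [].
have trR i x y z : R i x y -> R i y z -> R i x z.
  by case: i => [[]|]; [exact: tr1|exact: tr2|exact: tr3].
have := rfree_split (p := fun i : option bool => i == Some true) trR fR.
apply: rfree_sub => -[|] x y /=.
  move=> h; exists 1; apply: (@chainS _ _ _ _ y); last exact: chain0.
  by exists (Some true).
move=> [n ch]; exists n; elim: ch => {n x y} [x|n x y z Rxy _ ch].
  exact: chain0.
apply: chainS ch; case: Rxy => h; first by exists (Some false).
by exists None.
Qed.

(** * Orthogonality as freeness *)

Section Cycles.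
Variable T : Type.

Lemma rpath_iota (R : bool -> T -> T -> Prop) (y : nat -> T) c m k :
  (forall i, R (odd i) (y i) (y i.+1)) -> (forall i, y i <> y i.+1) ->
  c <> Some (odd m) ->
  rpath R c (y m) [seq (odd i, y i.+1) | i <- iota m k].
Proof.
move=> Ry ny; elim: k c m => //= k IH c m cm; split=> //.
by apply: IH => -[] /=; case: odd.
Qed.

(** The cycle in the definition of orthogonality, read from its first point,
    is a closed path of even length with colour [odd i] at step [i]. *)
Lemma rfree_orthogonal (E1 E2 : set (T * T)) :
  rfree (rel_pair (rel_of E1) (rel_of E2)) -> orthogonal_rel E1 E2.
Proof.
move=> fE n x n0 o1 o2; apply: contrapT => /forallNP nx.
have m0 : 0 < n.*2 by lia.
pose y i := x (Ordinal (ltn_pmod i m0)).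
have yS i : y i.+1 = x (ordS (Ordinal (ltn_pmod i m0))).
  by congr x; apply: val_inj => /=; rewrite -[in RHS]addn1 modnDml addn1.
have oddm i : odd (i %% n.*2) = odd i by lia.
have := fE (y 0) [seq (odd i, y i.+1) | i <- iota 0 n.*2].
have -> : rend (y 0) [seq (odd i, y i.+1) | i <- iota 0 n.*2] = y 0.
  rewrite /rend -map_comp -(prednK m0) -addn1 iotaD map_cat last_cat /=.
  congr x; apply: val_inj => /=.
  by rewrite add0n prednK // modnn mod0n.
move=> /(_ _ erefl); apply: contraPP; rewrite not_implyE; move=> _.
split; last by case: (n) n0.
apply: rpath_iota => // i; last by rewrite yS; exact: nx.
rewrite yS /rel_pair; case: ifP => oi.
  by apply: o1; rewrite /= oddm.
by apply: o2; rewrite /= oddm oi.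
Qed.

Lemma rpath_nth (R : bool -> T -> T -> Prop) x0 b c x s :
  rpath R c x s -> (forall l s', s = l :: s' -> l.1 = b) ->
  forall i, i < size s ->
    R (b (+) odd i) (nth x0 (x :: map snd s) i) (nth x0 (map snd s) i) /\
    nth x0 (x :: map snd s) i <> nth x0 (map snd s) i.
Proof.
elim: s b c x => //= -[d z] s IH b c x [_ /= h2 h3 h4] /(_ _ _ erefl) /= db.
move: h2 h4; rewrite db => h2 h4 [|i] /=; first by rewrite addbF.
rewrite ltnS => /(IH (~~ b) _ _ h4); rewrite addbN -addNb; apply=> -[d' ?] s' e.
by move: h4; rewrite e /= => -[+ _]; case: (d') (b) => -[].
Qed.

(** A closed reduced path of even length is a cycle up to a rotation by one
    step; one of odd length is shortened by composing its last and first steps,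
    which have the same colour. *)
Lemma orthogonal_rfree (E1 E2 : set (T * T)) :
  (forall x y z, E1 (x, y) -> E1 (y, z) -> E1 (x, z)) ->
  (forall x y z, E2 (x, y) -> E2 (y, z) -> E2 (x, z)) ->
  orthogonal_rel E1 E2 -> rfree (rel_pair (rel_of E1) (rel_of E2)).
Proof.
move=> tr1 tr2 orth; set R := rel_pair _ _.
have tr b x y z : R b x y -> R b y z -> R b x z.
  by case: b; [exact: tr1|exact: tr2].
have even x s : rpath R None x s -> rend x s = x -> ~~ odd (size s) ->
    s = [::].
  move=> ps es os; apply: contrapT => s0.
  have [b hb] : exists b, forall l s', s = l :: s' -> l.1 = b.
    by case: (s) s0 => // l s' _; exists l.1 => ? ? [->].
  have nn := rpath_nth x ps hb.
  set n := (size s)./2; have sn : size s = n.*2 by rewrite /n; lia.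
  have n0 : 0 < n by case: (s) s0 sn => //= ? ? _; lia.
  have m0 : 0 < n.*2 by lia.
  pose y i := nth x (x :: map snd s) (i %% n.*2).
  have yS i : y i.+1 = nth x (map snd s) (i %% n.*2).
    rewrite /y -addn1 -modnDml addn1.
    have := ltn_pmod i m0; rewrite leq_eqVlt => /orP[/eqP e|h].
      by rewrite e modnn /= -[LHS]es /rend (last_nth x) size_map sn -[in LHS]e.
    by rewrite (modn_small h).
  have ymod i j : i = j %[mod n.*2] -> y i = y j by rewrite /y => ->.
  have Ry i : R (b (+) odd i) (y i) (y i.+1) /\ y i <> y i.+1.
    have -> : odd i = odd (i %% n.*2) by lia.
    by rewrite yS; apply: nn; rewrite sn ltn_pmod.
  have yo (i : 'I_n.*2) : y (ordS i + b) = y (i + b).+1.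
    by apply: ymod; rewrite /= modnDml addSn.
  have [||i /esym] := orth n (fun i => y (i + b)) n0.
  - move=> i oi; rewrite yo; have [+ _] := Ry (i + b).
    by rewrite oddD oi oddb addTb addbN addbb.
  - move=> i oi; rewrite yo; have [+ _] := Ry (i + b).
    by rewrite oddD (negbTE oi) oddb addFb addbb.
  - by rewrite yo => /esym; have [_] := Ry (i + b).
move=> x s; have [k] := ubnP (size s); elim: k x s => // k IH x s sk ps es.
have [os|os] := boolP (odd (size s)); last exact: even ps es os.
case/lastP: s sk ps es os => // s [c z]; rewrite size_rcons => sk.
rewrite -cats1 => /rpath_cat[ps /= [h1 h2 h3 _]]; rewrite rend_cat /rend /=.
move=> ez; rewrite ez in h2 h3 *; rewrite /= => os.
case: s sk ps h1 h2 h3 os => [_ _ _ _ /nesym|[d y] s sk ps h1 h2 h3 os] //=.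
(* The closed path has odd length, so its first and last colours agree. *)
have ed : d = c.
  have key : forall e x s, rpath R (Some e) x s ->
      rlast (Some e) s = Some (e (+) odd (size s)).
    move=> e x' s'; elim: s' e x' => [|[e' y'] s' IH'] e x' /=.
      by rewrite addbF.
    move=> [q1 _ _ /IH']; rewrite /rlast /= => ->; congr Some.
    by case: e e' q1 => -[] //=; case: (odd _).
  move: ps h1 os => /= [_ _ _ /key]; rewrite /rlast /= negbK => -> h1 os.
  by move: h1; rewrite os; case: (d) (c) => -[].
move: ps h1 h2 h3; rewrite ed => /= -[_ Rxy nxy ps] h1 h2 h3.
have Rly := tr _ _ _ _ h2 Rxy.
rewrite {1}/rend /= -/(rend y s) in h2 h3 Rly.
have [ey|ney] := pselect (rend y s = y).
  have s0 : s = [::] by apply: IH (rpath_None ps) ey; move: sk => /=; lia.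
  by move: os => /=; rewrite s0.
have : s ++ [:: (c, y)] = [::].
  apply: (even y); last 2 first.
  - by rewrite rend_cat.
  - by rewrite size_cat addn1 /=.
  - apply/rpath_cat; split=> //; first exact: rpath_None ps.
    split=> //; move: h1; rewrite /rlast /=.
    by case: (s).
by case: s {sk os ps h1 h2 h3 IH Rly ney}.
Qed.

End Cycles.

(** * Subgroups, words and actions of presented groups *)

Local Open Scope group_scope.

Section Subgroups.
Variable G : groupType.
Implicit Types (A H : set G).

Lemma subgroupP H :
  subgroup H <-> H 1 /\ (forall x y, H x -> H y -> H (x / y)).
Proof.
rewrite /subgroup /group_closed /divg_closed; split=> -[h1 hd].
  split; first by move: h1; rewrite inE.
  by move=> x y Hx Hy; have := hd x y; rewrite !inE; apply.
split; first by rewrite inE.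
by move=> x y; rewrite !inE; exact: hd.
Qed.

Lemma subgroup1 H : subgroup H -> H 1. Proof. by move=> /subgroupP[]. Qed.

Lemma subgroupV H x : subgroup H -> H x -> H x^-1.
Proof. by move=> /subgroupP[h1 hd] Hx; rewrite -div1g; exact: hd. Qed.

Lemma subgroupM H x y : subgroup H -> H x -> H y -> H (x * y).
Proof.
move=> sH Hx Hy; have /subgroupP[_ hd] := sH.
by rewrite -[y]invgK; apply: hd => //; exact: subgroupV.
Qed.

Lemma subgroup_prod (I : Type) (r : seq I) (F : I -> G) H :
  subgroup H -> (forall i, H (F i)) -> H (\prod_(i <- r) F i).
Proof.
move=> sH HF; elim/big_ind : _ => //; first exact: subgroup1.
by move=> x y; exact: subgroupM.
Qed.

Lemma subgroupX H x n : subgroup H -> H x -> H (x ^+ n).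
Proof.
move=> sH Hx; elim: n => [|n IH]; first by rewrite expg0; exact: subgroup1.
by rewrite expgS; exact: subgroupM.
Qed.

Lemma subgroup_genP A : subgroup (subgroup_gen A).
Proof.
apply/subgroupP; split=> [H [sH _]|x y Hx Hy H /[dup] HA [sH _]].
  exact: subgroup1.
have /subgroupP[_ hd] := sH.
by apply: hd; [exact: Hx|exact: Hy].
Qed.

Lemma sub_subgroup_gen A : A `<=` subgroup_gen A.
Proof. by move=> x Ax H [_]; exact. Qed.

Lemma subgroup_gen_min A H : subgroup H -> A `<=` H -> subgroup_gen A `<=` H.
Proof. by move=> sH AH x; exact. Qed.

Lemma subgroup_gen1 (v g : G) : subgroup_gen [set v] g ->
  exists i, g = v ^+ i \/ g = v^-1 ^+ i.
Proof.
apply: (subgroup_gen_min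
  (H := [set g | exists i, g = v ^+ i \/ g = v^-1 ^+ i])); last first.
  by move=> _ ->; exists 1%N; left; rewrite expg1.
apply/subgroupP; split; first by exists 0%N; left; rewrite expg0.
have key i j : exists k, v ^+ i / v ^+ j = v ^+ k \/ v ^+ i / v ^+ j = v^-1 ^+ k.
  have [ij|/ltnW ij] := leqP j i.
    by exists (i - j); left; rewrite expgnFr.
  by exists (j - i); right; rewrite expVgn expgnFr // invgF.
move=> x y [i [|] ->] [j [|] ->].
- exact: key.
- by exists (i + j); left; rewrite expVgn invgK -expgnDr.
- by exists (i + j); right; rewrite -[v ^+ j]invgK -expVgn invgK -expgnDr.
- have c : v^-1 ^+ i / v^-1 ^+ j = v ^+ j / v ^+ i.
    have h := commuteV (commuteX2 j i (commute_refl v)).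
    by rewrite !expVgn invgK h.
  by rewrite c; exact: key.
Qed.

End Subgroups.

Section Words.
Variables (S : Type) (G : groupType) (f : S -> G).

Lemma eval_word_cat w1 w2 :
  eval_word f (w1 ++ w2) = eval_word f w1 * eval_word f w2.
Proof. by rewrite /eval_word big_cat. Qed.

Lemma eval_word_cons l w :
  eval_word f (l :: w) = (if l.2 then (f l.1)^-1 else f l.1) * eval_word f w.
Proof. by rewrite /eval_word big_cons. Qed.

Lemma eval_word_nil : eval_word f [::] = 1.
Proof. by rewrite /eval_word big_nil. Qed.

Lemma eval_word_inv w : exists w', eval_word f w' = (eval_word f w)^-1.
Proof.
elim: w => [|l w [w' e]]; first by exists [::]; rewrite eval_word_nil invg1.
exists (w' ++ [:: (l.1, ~~ l.2)]).
rewrite eval_word_cat e !eval_word_cons eval_word_nil mulg1 invgM /=.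
by case: l.2; rewrite ?invgK.
Qed.

Lemma subgroup_gen_word g :
  subgroup_gen (range f) g -> exists w, eval_word f w = g.
Proof.
apply: (subgroup_gen_min (H := [set g | exists w, eval_word f w = g])).
  apply/subgroupP; split; first by exists [::]; rewrite eval_word_nil.
  move=> x y [w <-] [w' <-]; have [w2 e] := eval_word_inv w'.
  by exists (w ++ w2); rewrite eval_word_cat e.
move=> _ [s _ <-]; exists [:: (s, false)].
by rewrite eval_word_cons eval_word_nil mulg1.
Qed.

End Words.

Section PresentedAction.
Variables (S : Type) (rels : set (word S)) (G : groupType) (f : S -> G).
Hypothesis presG : has_presentation rels f.
Variables (T : Type) (L : S * bool -> T -> T) (D : T -> Prop).
Hypothesis LD : forall l x, D x -> D (L l x).
Hypothesis LK : forall y b x, D x -> L (y, b) (L (y, ~~ b) x) = x.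
Hypothesis Lrel : forall r x, rels r -> D x -> foldr L x r = x.

Lemma foldrD w x : D x -> D (foldr L x w).
Proof. by move=> Dx; elim: w => //= l w; exact: LD. Qed.

(** Words with the same value act in the same way on [D]. *)
Lemma foldr_equiv w1 w2 x :
  word_equiv rels w1 w2 -> D x -> foldr L x w1 = foldr L x w2.
Proof.
move=> e; elim: e x => {w1 w2}
  [//|w1 w2 _ IH x Dx|w1 w2 w3 _ IH1 _ IH2 x Dx|u v y b x Dx|u v r rr x Dx].
- by rewrite IH.
- by rewrite IH1 // IH2.
- by rewrite !foldr_cat /= LK //; exact: foldrD.
- by rewrite !foldr_cat (@Lrel r) //; exact: foldrD.
Qed.

(** The action of a presented group defined by the action [L] of the letters,
    through a chosen word representing each element.  It is an action on the
    set [D] where [L] respects the relators. *)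
Definition pact (g : G) : T -> T :=
  foldr L ^~ (projT1 (cid (presG.1 g))).

Lemma pact_word w x : D x -> pact (eval_word f w) x = foldr L x w.
Proof.
move=> Dx; apply: foldr_equiv Dx; apply/presG.2.
exact: projT2 (cid (presG.1 _)).
Qed.

Lemma pactD g x : D x -> D (pact g x).
Proof. by move=> Dx; exact: foldrD. Qed.

Lemma pact1 x : D x -> pact 1 x = x.
Proof. by move=> Dx; rewrite -(eval_word_nil f) pact_word. Qed.

Lemma pactM g h x : D x -> pact (g * h) x = pact g (pact h x).
Proof.
move=> Dx; have [w <-] := presG.1 g; have [w' <-] := presG.1 h.
rewrite -eval_word_cat !pact_word //; first by rewrite foldr_cat.
exact: foldrD.
Qed.

Lemma pact_gen s x : D x -> pact (f s) x = L (s, false) x.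
Proof.
move=> Dx; have := pact_word [:: (s, false)] Dx.
by rewrite eval_word_cons eval_word_nil mulg1.
Qed.

(** An action of the subgroup generated by [A] that agrees with [pact] on [A]
    agrees with it everywhere on that subgroup. *)
Lemma pact_eqP (A : set G) (act : G -> T -> T) :
  (forall x, D x -> act 1 x = x) ->
  (forall g h x, subgroup_gen A g -> subgroup_gen A h -> D x ->
     act (g * h) x = act g (act h x)) ->
  (forall g x, A g -> D x -> pact g x = act g x) ->
  forall g x, subgroup_gen A g -> D x -> pact g x = act g x.
Proof.
move=> act1 actM eA g x Ag Dx.
suff [_] : [set g | subgroup_gen A g /\ forall x, D x -> pact g x = act g x] g.
  exact.
have sA := subgroup_genP A.
apply: subgroup_gen_min Ag; last first.
  by move=> h Ah; split=> [|y Dy]; [exact: sub_subgroup_gen|exact: eA].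
apply/subgroupP; split.
  by split=> [|y Dy]; [exact: subgroup1|rewrite pact1 // act1].
move=> h k [Ah eh] [Ak ek].
have eV y : D y -> pact k^-1 y = act k^-1 y.
  move=> Dy; have Dk := pactD k^-1 Dy.
  rewrite -[in RHS](pact1 Dy) -(mulgV k) pactM // ek //.
  rewrite -actM //; first by rewrite mulVg act1.
  exact: (subgroupV sA).
split=> [|y Dy]; first by apply: (subgroupM sA Ah); exact: (subgroupV sA).
have Dk := pactD k^-1 Dy.
rewrite pactM // eh // eV // -actM //; exact: (subgroupV sA).
Qed.

End PresentedAction.

(** * Free groups are torsion-free *)

Section ReducedWords.
Variable I : eqType.
Implicit Types (l : I * bool) (w : seq (I * bool)).

(** The formal inverse of a letter. *)
Definition linv l : I * bool := (l.1, ~~ l.2).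

(** No letter is followed by its inverse. *)
Definition reduced w : bool := sorted (fun l l' => l' != linv l) w.

(** Left multiplication of a reduced word by a letter. *)
Definition push l w :=
  if w is l' :: w' then if l' == linv l then w' else l :: w else [:: l].

Lemma linvK : involutive linv.
Proof. by case=> y b; rewrite /linv /= negbK. Qed.

Lemma push_reduced l w : reduced w -> reduced (push l w).
Proof.
case: w => //= l' w; rewrite /reduced; case: ifPn => /= [_ /path_sorted //|].
by move=> -> ->.
Qed.

Lemma pushK l w : reduced w -> push l (push (linv l) w) = w.
Proof.
case: w => [_|l' w] /=; first by rewrite eqxx.
rewrite /reduced linvK /=; have [->|nl] := eqVneq l' l.
  by case: w => //= l2 w /andP[/negPf -> _].
by rewrite /= eqxx.
Qed.

Lemma foldr_push w : reduced w -> foldr push [::] w = w.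
Proof.
elim: w => //= l w IH rw; rewrite IH; last exact: path_sorted rw.
by case: w rw {IH} => //= l' w /andP[/negPf ->].
Qed.

Lemma not_reduced w : ~~ reduced w ->
  exists p l q, w = p ++ l :: linv l :: q.
Proof.
elim: w => //= l [//|l' w] IH /=.
rewrite negb_and negbK => /orP[/eqP ->|/IH[p [l2 [q ->]]]].
  by exists [::], l, w.
by exists (l :: p), l2, q.
Qed.

Lemma reduced_flatten_nseq l w m :
  reduced (l :: rcons w l) -> reduced (flatten (nseq m (l :: w))).
Proof.
rewrite /reduced /= rcons_path => /andP[pw lw].
suff key k : path (fun l l' => l' != linv l) (last l w)
    (flatten (nseq k (l :: w))).
  by case: m => //= m; rewrite cat_path pw /=; exact: key.
by elim: k => //= k IH; rewrite lw cat_path pw.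
Qed.

End ReducedWords.

Section TorsionFree.
Variables (n k : nat) (ord : 'I_k -> nat) (G : groupType).
Variables (a : 'I_n -> G) (s : 'I_k -> G).
Hypothesis presG : has_presentation (cyclic_relators n ord) (sum_fun a s).

Lemma eval_word_inl w :
  eval_word (sum_fun a s) [seq (inl l.1, l.2) | l <- w] = eval_word a w.
Proof. by rewrite /eval_word big_map. Qed.

(** G acts on reduced words: the [a i] by [push], the [s j] trivially.  A
    reduced word sends the empty word to itself, hence is nontrivial in G. *)
Lemma reduced_eval_neq1 w : reduced w -> eval_word a w = 1 -> w = [::].
Proof.
move=> rw e1.
pose L (l : ('I_n + 'I_k) * bool) :=
  if l.1 is inl i then push (i, l.2) else id.
have LD l w' : reduced w' -> reduced (L l w').
  by move=> rw'; rewrite /L; case: l.1 => // i; exact: push_reduced.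
have LK y b w' : reduced w' -> L (y, b) (L (y, ~~ b) w') = w'.
  by rewrite /L /=; case: y => // i; exact: pushK.
have Lrel r w' : cyclic_relators n ord r -> reduced w' -> foldr L w' r = w'.
  by move=> [j ->] _; elim: (ord j).
have := pact_word presG (D := fun w => reduced w) LD LK Lrel
  [seq (inl l.1, l.2) | l <- w] (x := [::]) isT.
rewrite eval_word_inl e1 (pact1 presG LD LK Lrel) // => e.
rewrite -(foldr_push rw) [RHS]e foldr_map; elim: (w) => //= -[i b] w' -> //.
Qed.

Lemma free_torsion_free v m : subgroup_gen (range a) v -> v <> 1 ->
  v ^+ m = 1 -> m = 0%N.
Proof.
move=> /subgroup_gen_word[w0 ew0] v1 vm; apply/eqP; apply: contrapT => /eqP m0.
(* A conjugate of v represented by a word c of minimal length is cyclically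
   reduced. *)
pose P c := exists u, eval_word a c = u * v / u.
have [c [Pc cmin]] : exists c, P c /\ forall c', P c' -> (size c <= size c')%N.
  have exP : exists j, `[< exists c, P c /\ size c = j >].
    exists (size w0); apply/asboolP; exists w0; split=> //; exists 1.
    by rewrite ew0 invg1 mulg1 mul1g.
  have /asboolP[c [Pc sc]] := projT2 (sigW exP).
  case: (ex_minnP exP) => j /asboolP[c' [Pc' <-]] jmin.
  by exists c'; split=> // c2 Pc2; apply: jmin; apply/asboolP; exists c2.
have [u eu] := Pc.
have ek j : eval_word a (flatten (nseq j c)) = u * v ^+ j / u.
  elim: j => [|j IH] /=; first by rewrite eval_word_nil expg0 mulg1 mulgV.
  by rewrite eval_word_cat IH eu expgS !mulgA mulgVK.
case: c Pc cmin eu ek => [|l c] Pc cmin eu ek.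
  apply: v1; move: eu; rewrite eval_word_nil => /esym/eqP.
  by rewrite divg_eq1 -{2}[u]mulg1 => /eqP/mulgI.
suff /(reduced_flatten_nseq m)/reduced_eval_neq1 : reduced (l :: rcons c l).
  by rewrite ek vm mulg1 mulgV => /(_ erefl); case: (m) m0.
apply: contrapT => /negP/not_reduced[p [l' [q e]]].
have canc l1 w1 : eval_word a (l1 :: linv l1 :: w1) = eval_word a w1.
  by rewrite !eval_word_cons /=; case: l1.2; rewrite /= ?mulKg ?mulVKg.
case/lastP: q e => [|q l2] e.
  have /rcons_inj[ec el] : rcons (l :: c) l = rcons (p ++ [:: l']) (linv l').
    by rewrite rcons_cons e -cats1 -catA.
  case: p e ec => [|l3 p] e /= [e1 e2].
    by move: el; rewrite e1 /linv; case: (l') => ? [] [].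
  (* The first and the last letter of c cancel. *)
  have : P p.
    have el' : l' = linv l by rewrite el linvK.
    exists (eval_word a [:: linv l] * u); rewrite invgM !mulgA.
    have := eu; rewrite e2 el' -cat1s !eval_word_cat => eu'.
    rewrite -(mulgA _ u) -(mulgA _ (u * v)) -eu' !mulgA.
    rewrite /eval_word !big_seq1 /=.
    by case: l.2; rewrite /= ?invgK ?mulgV ?mulVg ?mul1g ?mulgK ?mulgVK.
  move=> /cmin; rewrite /= e2 size_cat /=; lia.
have {e}/rcons_inj[e _] : rcons (l :: c) l = rcons (p ++ l' :: linv l' :: q) l2.
  by rewrite rcons_cons e -!rcons_cons rcons_cat.
have : P (p ++ q).
  by exists u; rewrite -eu e !eval_word_cat canc.
by move=> /cmin; rewrite e !size_cat /=; lia.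
Qed.

End TorsionFree.

(** * Normal forms and ping-pong *)

Section NormalForms.
Variables (G : groupType) (A : bool -> set G).
Hypothesis sA : forall c, subgroup (A c).
Implicit Types (c : bool) (g : G) (w : seq (bool * G)).

(** Normal forms of the free product of the subgroups [A true] and
    [A false]: words of nontrivial elements of alternating factors, the first
    letter not lying in the factor [d]. *)
Fixpoint nf (d : option bool) w : Prop :=
  if w is l :: w' then
    [/\ d <> Some l.1, A l.1 l.2, l.2 <> 1 & nf (Some l.1) w']
  else True.

(** Adds the letter [g], unless it is trivial. *)
Definition lcons c g w := if g == 1 then w else (c, g) :: w.

(** The component of [w] in the factor [c]: the first letter if it lies in
    that factor, and 1 otherwise. *)
Definition nhead c w := if w is l :: _ then if l.1 == c then l.2 else 1 else 1.

(** What remains of [w] after its component in the factor [c]. *)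
Definition ntail c w :=
  if w is l :: w' then if l.1 == c then w' else w else [::].

(** Left multiplication of a normal form by an element of the factor [c]. *)
Definition nmul c g w := lcons c (g * nhead c w) (ntail c w).

Lemma nf_weak d w : nf d w -> nf None w.
Proof. by case: w => //= l w []. Qed.

Lemma nhead_in c w : nf None w -> A c (nhead c w).
Proof.
case: w => [|l w] /=; first by move=> _; exact: subgroup1.
move=> [_ Al _ _]; case: eqP => [<- //|_]; exact: subgroup1.
Qed.

Lemma ntail_nf c w : nf None w -> nf (Some c) (ntail c w).
Proof.
case: w => //= l w [_ h1 h2 h3]; case: eqP => [<- //|ne] /=.
by split=> // -[e]; apply: ne.
Qed.

Lemma lcons_nf c g w : A c g -> nf (Some c) w -> nf None (lcons c g w).
Proof.
by move=> Ag nw; rewrite /lcons; case: eqP => [_|g1] /=; first exact: nf_weak nw.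
Qed.

Lemma lcons_head c g w : nf (Some c) w -> nhead c (lcons c g w) = g.
Proof.
rewrite /lcons; case: eqP => [->|_]; last by rewrite /= eqxx.
by case: w => //= l w [h _ _ _]; case: eqP => // e; case: h; rewrite e.
Qed.

Lemma lcons_tail c g w : nf (Some c) w -> ntail c (lcons c g w) = w.
Proof.
rewrite /lcons; case: eqP => [_|_]; last by rewrite /= eqxx.
by case: w => //= l w [h _ _ _]; case: eqP => // e; case: h; rewrite e.
Qed.

Lemma nmul_nf c g w : A c g -> nf None w -> nf None (nmul c g w).
Proof.
move=> Ag nw; apply: lcons_nf; last exact: ntail_nf.
by apply: subgroupM => //; exact: nhead_in.
Qed.

Lemma nmulM c g h w : nf None w -> nmul c (g * h) w = nmul c g (nmul c h w).
Proof.
move=> nw; have nt := ntail_nf c nw.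
by rewrite {2 3}/nmul /nmul lcons_head // lcons_tail // mulgA.
Qed.

Lemma nmul1 c w : nf None w -> nmul c 1 w = w.
Proof.
rewrite /nmul mul1g; case: w => [|l w] /=; first by rewrite /lcons eqxx.
move=> [_ _ l1 _]; case: eqP => [<-|_]; rewrite /lcons ?eqxx //.
by case: eqP l1 => //; case: l.
Qed.

End NormalForms.

Section PingPong.
Variables (G : groupType) (A : bool -> set G).

(** [A true] and [A false] generate their free product: no nonempty
    alternating product of nontrivial elements is trivial. *)
Definition free_pair : Prop := rfree (fun c x y => A c (y / x)).

(** Ping-pong: the nontrivial elements of [A c] map the set [P (~~ c)] and
    the base point [x0] into [P c], and [x0] lies in neither set. *)
Lemma ping_pong (T : Type) (act : G -> T -> T) (D : T -> Prop) (P : bool -> T -> Prop) (x0 : T) :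
  (forall x, D x -> act 1 x = x) ->
  (forall g h x, D x -> act (g * h) x = act g (act h x)) ->
  (forall c g x, A c g -> D x -> D (act g x)) ->
  D x0 -> (forall c, ~ P c x0) ->
  (forall c g x, A c g -> g <> 1 -> D x -> P (~~ c) x \/ x = x0 ->
     P c (act g x)) ->
  free_pair.
Proof.
move=> act1 actM actD Dx0 Px0 PP g s.
suff key c h x : D x -> (forall d, c = Some d -> P d x) ->
    (c = None -> x = x0) -> rpath (fun c x y => A c (y / x)) c h s ->
    s <> [::] -> exists d, P d (act (rend h s / h) x).
  move=> ps es; apply: contrapT => s0.
  have [//|//|d] := key None g x0 Dx0 _ _ ps s0.
  by rewrite es mulgV act1 //; exact: Px0.
elim: s c h x => //= l s IH c h x Dx cP c0 [h1 h2 h3 h4] _.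
have nlh : l.2 / h <> 1 by move=> /divg1_eq/esym.
have Pl : P l.1 (act (l.2 / h) x).
  apply: PP => //; case: c cP c0 h1 => [d|] cP c0 h1; last by right; exact: c0.
  by left; have := cP d erefl; case: (d) (l.1) h1 => -[].
case: s IH h4 => [_ _|l' s IH h4]; first by exists l.1.
have [||//|//|//|d Pd] := IH (Some l.1) l.2 (act (l.2 / h) x).
- exact: (actD l.1).
- by move=> d [<-].
exists d; move: Pd; rewrite -actM //.
by rewrite mulgA mulgVK.
Qed.

(** On a set where the action is free, each orbit is a copy of the group, so
    the orbit relations of a free pair are free. *)
Lemma free_pair_orbit (T : Type) (act : G -> T -> T) (B : set T) :
  (forall x, act 1 x = x) -> (forall g h x, act (g * h) x = act g (act h x)) ->
  (forall g x, B x -> act g x = x -> g = 1) ->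
  free_pair ->
  rfree (fun c x y => [/\ exists2 g, A c g & act g x = y, B x & B y]).
Proof.
move=> act1 actM fr fA x s ps es.
have Bx : s <> [::] -> B x by case: (s) ps => //= l s' [_ []].
apply: contrapT => /[dup] s0 /Bx {}Bx.
suff key c g : rpath (fun c x y =>
      [/\ exists2 g, A c g & act g x = y, B x & B y]) c (act g x) s ->
    exists s', [/\ rpath (fun c x y => A c (y / x)) c g s',
      rend (act g x) s = act (rend g s') x & s' = [::] -> s = [::]].
  rewrite -(act1 x) in ps; have [s' [ps' es' s0']] := key _ _ ps.
  apply/s0/s0'/fA; first exact: ps'.
  by apply: (fr _ x) => //; rewrite -es' act1.
elim: s c g {ps es Bx s0} => [|l s IH] c g /=; first by exists [::].
move=> [h1 [[h Ah eh] _ _] h3]; rewrite -eh -actM => /IH[s' [ps' es' _]].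
exists ((l.1, h * g) :: s'); split=> //; last first.
  by rewrite -[RHS]es' /rend /= actM eh.
split=> //=; first by rewrite mulgK.
by move=> e; apply: h3; rewrite -eh -actM -e.
Qed.

End PingPong.

Lemma nf_sub (G : groupType) (A A' : bool -> set G) d w :
  (forall c, A c `<=` A' c) -> nf A d w -> nf A' d w.
Proof.
by move=> sub; elim: w d => //= l w IH d [h1 /sub h2 h3 /IH].
Qed.

Section FreeProduct.
Variables (n k : nat) (ord : 'I_k -> nat) (G : groupType).
Variables (a : 'I_n -> G) (s : 'I_k -> G).
Hypothesis presG : has_presentation (cyclic_relators n ord) (sum_fun a s).

(** The two free factors of G. *)
Definition factor (c : bool) : set G :=
  if c then subgroup_gen (range a) else subgroup_gen (range s).

Lemma subgroup_factor c : subgroup (factor c).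
Proof. by case: c; exact: subgroup_genP. Qed.

Let sF := subgroup_factor.

Definition nf_letter (l : ('I_n + 'I_k) * bool) :=
  match l.1 with
  | inl i => nmul true (if l.2 then (a i)^-1 else a i)
  | inr j => nmul false (if l.2 then (s j)^-1 else s j)
  end.

Let D w := nf factor None w.

Lemma gen_factor (x : 'I_n + 'I_k) :
  factor (if x is inl _ then true else false) (sum_fun a s x).
Proof. by case: x => i; apply: sub_subgroup_gen; exists i. Qed.

Lemma letterD l w : D w -> D (nf_letter l w).
Proof.
case: l => -[] i b Dw; apply: nmul_nf => //=.
  have := gen_factor (inl i); case: b => //; exact: (subgroupV (sF _)).
have := gen_factor (inr i); case: b => //; exact: (subgroupV (sF _)).
Qed.

Lemma letterK y b w : D w -> nf_letter (y, b) (nf_letter (y, ~~ b) w) = w.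
Proof.
move=> Dw; rewrite /nf_letter /=.
case: y => i; rewrite -(@nmulM _ factor) //; case: b => /=;
  by rewrite ?mulgV ?mulVg (@nmul1 _ factor).
Qed.

Lemma relator_trivial j : s j ^+ ord j = 1.
Proof.
have : word_equiv (cyclic_relators n ord) (nseq (ord j) (inr j, false)) [::].
  have := @word_equiv_rel _ (cyclic_relators n ord) [::] [::]
    (nseq (ord j) (inr j, false)).
  by rewrite cats0 /=; apply; exists j.
move=> /presG.2; rewrite eval_word_nil => <-.
elim: (ord j) => [|m IH]; first by rewrite expg0 /= eval_word_nil.
by rewrite expgS /= eval_word_cons IH.
Qed.

Lemma relatorD r w : cyclic_relators n ord r -> D w -> foldr nf_letter w r = w.
Proof.
move=> [j ->] Dw; rewrite -[RHS](@nmul1 _ factor false) // -(relator_trivial j).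
elim: (ord j) => [|m IH]; first by rewrite expg0 (@nmul1 _ factor).
by rewrite expgS (@nmulM _ factor) //= IH.
Qed.

Let act := pact presG nf_letter.

Lemma nf_actE c g w : factor c g -> D w -> act g w = nmul c g w.
Proof.
move=> Fg Dw.
case: c Fg => Fg;
  [apply: (pact_eqP letterD letterK relatorD (act := nmul true)) Fg Dw
  |apply: (pact_eqP letterD letterK relatorD (act := nmul false)) Fg Dw].
- by move=> x Dx; exact: (@nmul1 _ factor).
- by move=> g1 h x _ _ Dx; exact: (@nmulM _ factor).
- by move=> _ x [i _ <-] Dx; exact: (pact_gen _ letterD letterK relatorD (inl i)).
- by move=> x Dx; exact: (@nmul1 _ factor).
- by move=> g1 h x _ _ Dx; exact: (@nmulM _ factor).
- by move=> _ x [i _ <-] Dx; exact: (pact_gen _ letterD letterK relatorD (inr i)).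
Qed.

Lemma nf_act1 w : D w -> act 1 w = w.
Proof. exact: (pact1 _ letterD letterK relatorD). Qed.

Lemma nf_actM g h w : D w -> act (g * h) w = act g (act h w).
Proof. exact: (pactM _ letterD letterK relatorD). Qed.

Lemma nf_actD g w : D w -> D (act g w).
Proof. exact: (pactD _ letterD). Qed.

(** Ping-pong on normal forms: [P c] is the set of normal forms whose first
    letter lies in the factor [c]. *)
Lemma free_pair_factor : free_pair factor.
Proof.
apply: (@ping_pong _ _ _ act D
  (fun c w => if w is l :: _ then l.1 = c else False) [::]) => //.
- exact: nf_act1.
- exact: nf_actM.
- by move=> c g w _; exact: nf_actD.
- by move=> c [].
- move=> c g w Fg g1 Dw hw; rewrite (nf_actE Fg) // /nmul.
  have -> : nhead c w = 1.
    by case: w {Dw} hw => //= l w [->|//]; case: (c).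
  by rewrite mulg1 /lcons; case: (g =P 1).
Qed.

Variables v t : G.
Hypotheses (Fv : subgroup_gen (range a) v) (v1 : v <> 1).
Hypothesis St : subgroup_gen (range s) t.

Let A (c : bool) : set G := if c then subgroup_gen [set v] else factor false.
Let Dv w := nf A None w.

Let sA c : subgroup (A c).
Proof. by case: c; exact: subgroup_genP. Qed.

Let A_factor c : A c `<=` factor c.
Proof.
case: c => //=; apply: subgroup_gen_min; first exact: (sF true).
by move=> _ ->.
Qed.

Let DvD w : Dv w -> D w. Proof. exact: (nf_sub A_factor). Qed.

Let actE c g w : A c g -> Dv w -> act g w = nmul c g w.
Proof. by move=> Ag /DvD; apply: nf_actE; exact: A_factor. Qed.

Let actDv c g w : A c g -> Dv w -> Dv (act g w).
Proof. by move=> Ag Dw; rewrite (actE Ag) //; exact: nmul_nf. Qed.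

Let Av : A true v. Proof. exact: sub_subgroup_gen. Qed.

(* The normal forms starting with a positive power of u. *)
Let starts u (w : seq (bool * G)) : Prop :=
  exists j w', w = (true, u ^+ j.+1) :: w'.

Let startsN w : starts v w -> starts v^-1 w -> False.
Proof.
move=> [i [w1 ->]] [j [w2 [e _]]].
have : v ^+ (i.+1 + j.+1) = 1 by rewrite expgnDr e expVgn mulVg.
by move/(free_torsion_free presG Fv v1).
Qed.

Let push_power u w : u = v \/ u = v^-1 -> Dv w -> ~ starts u^-1 w ->
  starts u (act u w).
Proof.
move=> uv Dw ns.
have Au : A true u by case: uv => ->; [|apply: (subgroupV (sA _))].
have u0 j : u ^+ j.+1 <> 1.
  case: uv => ->; first by move/(free_torsion_free presG Fv v1).
  by rewrite expVgn => /eqP; rewrite invg_eq1 => /eqP/(free_torsion_free presG Fv v1).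
have un : u <> 1 by have := u0 0%N; rewrite expg1.
rewrite (actE Au) // /nmul /lcons.
have nohead : (if w is l :: _ then l.1 = false else True) ->
    starts u (if u * nhead true w == 1 then ntail true w
              else (true, u * nhead true w) :: ntail true w).
  move=> hw; have -> : nhead true w = 1 by case: (w) hw => //= l _ ->.
  by rewrite mulg1; case: eqP => // _; exists 0%N, (ntail true w); rewrite expg1.
case: w Dw ns nohead => [|[[] h] w] Dw ns nohead; [exact: nohead| |exact: nohead].
move: Dw => /= [_ Ah h1 _].
have : exists i, h = u ^+ i \/ h = u^-1 ^+ i.
  have [i e] := subgroup_gen1 Ah; exists i.
  by case: uv => ->; rewrite ?invgK //; case: e; [right|left].
move=> [[|i]] [e|e]; rewrite ?expg0 // in e.
  by rewrite e -expgS; case: eqP => [/u0 //|_]; exists i.+1, w.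
by case: ns; exists i, w; rewrite e.
Qed.

Let actS h w : A false h -> Dv w -> starts v w \/ starts v^-1 w ->
  act h w = if h == 1 then w else (false, h) :: w.
Proof.
move=> Ah Dw hw; rewrite (actE Ah) // /nmul.
by case: hw Dw => -[j [w' ->]] _; rewrite /= mulg1.
Qed.

Let At : A false t. Proof. exact: St. Qed.
Let AtV : A false t^-1. Proof. exact: (subgroupV (sA _)). Qed.
Let AvV : A true v^-1. Proof. exact: (subgroupV (sA _)). Qed.

(* The set into which the nontrivial powers of v t push the other normal
   forms: the positive powers into its first part, the negative ones into the
   second. *)
Let attracted w := starts v w \/ starts v^-1 (act t w).

Let attractedN w : Dv w -> starts v w -> starts v^-1 (act t w) -> False.
Proof.
move=> Dw sv; rewrite actS //; last by left.
by case: eqP => [_|_ [? [? []]] //]; exact: startsN.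
Qed.

(** Ping-pong on the normal forms whose letters in the first factor are
    powers of [v]: the nontrivial powers of [v * t] map into [attracted], and
    the nontrivial elements of the second factor map into the nonempty normal
    forms outside [attracted].  The empty normal form is the base point. *)
Lemma free_pair_twist :
  free_pair (fun c => if c then subgroup_gen [set v * t]
                      else subgroup_gen (range s)).
Proof.
have actM g h w : Dv w -> act (g * h) w = act g (act h w).
  by move=> /DvD; exact: nf_actM.
have actw w : Dv w -> Dv (act (v * t) w).
  by move=> Dw; rewrite actM //; apply: (actDv Av); exact: (actDv At).
have actwV w : Dv w -> Dv (act (v * t)^-1 w).
  by move=> Dw; rewrite invgM actM //; apply: (actDv AtV); exact: (actDv AvV).
have actX u i w : (forall w, Dv w -> Dv (act u w)) -> Dv w -> Dv (act (u ^+ i) w).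
  move=> uD Dw; elim: i => [|i IH].
    by rewrite expg0 nf_act1 //; exact: DvD.
  by rewrite expgS actM //; exact: uD.
apply: (@ping_pong _ _ _ act Dv
  (fun c w => if c then attracted w else w <> [::] /\ ~ attracted w) [::]) => //.
- by move=> w /DvD; exact: nf_act1.
- case=> g w; last exact: (@actDv false).
  by move=> /subgroup_gen1[i [] ->] Dw; exact: actX.
- case=> [[]|[]//]; first by move=> [? []].
  rewrite (actE At) // /nmul /lcons /= mulg1 => -[? [? ]].
  by case: eqP.
case=> g w Bg g1 Dw hw /=.
  have {hw} nw : ~ attracted w.
    case: hw => [[]//|->] [[? [? ]]//|].
    rewrite (actE At) // /nmul /lcons /= mulg1 => -[? [? ]].
    by case: eqP.
  have [i e] := subgroup_gen1 Bg.
  case: i e => [[e|e]|i [e|e]]; first 2 last.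
  + left; rewrite {}e; have {}nw : ~ starts v^-1 (act t w) by move=> h; apply: nw; right.
    have step x : Dv x -> ~ starts v^-1 (act t x) -> starts v (act (v * t) x).
      by move=> Dx nx; rewrite actM //; apply: push_power => //; [left|exact: (actDv At)].
    elim: i => [|i IH]; first by rewrite expg1; exact: step.
    rewrite expgS actM //; apply: step; first exact: actX.
    move=> h; apply: attractedN IH h; exact: actX.
  + right; rewrite {}e; have {}nw : ~ starts v w by move=> h; apply: nw; left.
    have step x : Dv x -> ~ starts v x -> starts v^-1 (act t (act (v * t)^-1 x)).
      move=> Dx nx; rewrite -actM // invgM mulgA mulgV mul1g.
      by apply: push_power => //; [right|rewrite invgK].
    elim: i => [|i IH]; first by rewrite expg1; exact: step.
    rewrite expgS actM //; apply: step; first exact: actX.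
    move=> h; apply: attractedN h IH; exact: actX.
  + by case: g1; rewrite e expg0.
  + by case: g1; rewrite e expg0.
have Ag : A false g by [].
have gt1 : t * g * t^-1 <> 1.
  by move=> /divg1_eq; rewrite -[RHS]mulg1 => /mulgI.
have Atg : A false (t * g) by exact: (subgroupM (sA _)).
have Agt : A false (g * t^-1) by exact: (subgroupM (sA _)).
have Atgt : A false (t * g * t^-1) by exact: (subgroupM (sA _)).
have nf_false h w' : ~ starts v ((false, h) :: w') /\ ~ starts v^-1 ((false, h) :: w').
  by split=> -[? [? []]].
case: hw => [[sv|svt]|->].
- rewrite /attracted -(actM t) //.
  have -> : act g w = (false, g) :: w.
    by rewrite actS //; [case: eqP|left].
  split=> // -[/(nf_false _ _).1 //|].
  rewrite actS //; last by left.
  by case: eqP => [_ /(startsN sv)|_ /(nf_false _ _).2].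
- have [y [{}svt Dy ew]] : exists y, [/\ starts v^-1 y, Dv y & w = act t^-1 y].
    exists (act t w); split=> //; first exact: (actDv At).
    by rewrite -actM // mulVg nf_act1 //; exact: DvD.
  rewrite /attracted -(actM t) // ew -!actM //.
  have sy : starts v y \/ starts v^-1 y by right.
  rewrite !actS //; case: ((t * g * t^-1) =P 1) => // _.
  split; first by case: svt => ? [? ->]; case: eqP.
  move=> [|/(nf_false _ _).2 //].
  by case: eqP => [_ /startsN/(_ svt)|_ /(nf_false _ _).1].
- rewrite /attracted -(actM t) //.
  rewrite (actE Ag) // (actE Atg) // /nmul /lcons /= !mulg1; case: eqP => // _.
  split=> // -[/(nf_false _ _).1 //|].
  by case: eqP => [_ [? []]|_ /(nf_false _ _).2].
Qed.

End FreeProduct.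

Local Close Scope group_scope.

(** * Expansions of real numbers *)

Import Order.TTheory GRing.Theory Num.Theory.
Import numFieldNormedType.Exports.

Local Open Scope ring_scope.

Section Expansions.
Variables (R : realType) (b : R).
Implicit Types (x : R) (c : nat -> bool).

(** The map producing the next remainder in base [b], for digits 0 and 1. *)
Definition digit_map x : R := b * x - (1 <= b * x)%R%:R.

(** The digits of [x] in base [b], truncated to 0 and 1. *)
Definition digits x (n : nat) : bool := 1 <= b * iter n digit_map x.

Fixpoint partial_sum c (n : nat) : R :=
  if n is n'.+1 then ((c 0%N)%:R + partial_sum (fun i => c i.+1) n') / b else 0.

(** The number with the given digits.  In base 2 this is the usual binary
    expansion; in larger bases it embeds the Cantor space. *)
Definition expansion c : R := sup (range (partial_sum c)).

Lemma digitsS x n : digits x n.+1 = digits (digit_map x) n.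
Proof. by rewrite /digits iterSr. Qed.

Hypothesis b2 : 2 <= b.

Let b0 : 0 < b. Proof. by move: b2; lra. Qed.
Let b1 : 0 < b - 1. Proof. by move: b2; lra. Qed.

Lemma partial_sum_bounds c n : 0 <= partial_sum c n <= (b - 1)^-1.
Proof.
elim: n c => [|n IH] c /=; first by rewrite lexx invr_ge0 ltW.
have /andP[h1 h2] := IH (fun i => c i.+1).
have c1 : 0 <= ((c 0%N)%:R : R) <= 1 by case: (c 0%N); rewrite /= ?lexx ?ler01.
rewrite ler_pdivlMr // mul0r ler_pdivrMr // [X in _ && (_ <= X)](_ : _ = 1 + (b - 1)^-1).
  by move: c1 => /andP[? ?]; apply/andP; split; [exact: addr_ge0|exact: lerD].
by field; rewrite gt_eqF.
Qed.

Lemma partial_sum_nondecreasing c : nondecreasing_seq (partial_sum c).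
Proof.
apply/nondecreasing_seqP => n; elim: n c => [|n IH] c.
  by have /andP[] := partial_sum_bounds c 1.
by rewrite [leRHS]/= [leLHS]/= ler_pM2r ?invr_gt0 // lerD2l; exact: IH.
Qed.

Lemma cvg_expansion c : partial_sum c @ \oo --> expansion c.
Proof.
apply: nondecreasing_cvgn; first exact: partial_sum_nondecreasing.
by exists (b - 1)^-1 => _ [n _ <-]; have /andP[] := partial_sum_bounds c n.
Qed.

Lemma expansion_bounds c : 0 <= expansion c <= (b - 1)^-1.
Proof.
have cv := @cvg_expansion c; rewrite -(cvg_lim _ cv) //; apply/andP; split.
  apply: limr_ge; first by apply: cvgP cv.
  by near=> n; have /andP[] := partial_sum_bounds c n.
apply: limr_le; first by apply: cvgP cv.
by near=> n; have /andP[] := partial_sum_bounds c n.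
Unshelve. all: by end_near. Qed.

Lemma expansion_rec c :
  b * expansion c = (c 0%N)%:R + expansion (fun i => c i.+1).
Proof.
have h1 : (fun n => b * partial_sum c n.+1) @ \oo --> b * expansion c.
  apply: cvgMr; have := @cvg_expansion c; by rewrite -cvg_shiftS.
have h2 : (fun n => b * partial_sum c n.+1) @ \oo -->
    (c 0%N)%:R + expansion (fun i => c i.+1).
  under eq_fun do rewrite /= mulrC divfK ?gt_eqF //.
  by apply: cvgD; [exact: cvg_cst|exact: cvg_expansion].
exact: cvg_unique h1 h2.
Qed.

(** In base greater than 2 the tails are less than 1, so the digits are
    recovered. *)
Lemma digits_expansion c : 2 < b -> digits (expansion c) = c.
Proof.
move=> b3; apply/funext => n.
have key d : digit_map (expansion d) = expansion (fun i => d i.+1) /\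
    digits (expansion d) 0 = d 0%N.
  have E1 : expansion (fun i => d i.+1) < 1.
    have /andP[_] := expansion_bounds (fun i => d i.+1).
    move=> /le_lt_trans; apply; rewrite invf_lt1 //; lra.
  have /andP[E0 _] := expansion_bounds (fun i => d i.+1).
  rewrite /digits /digit_map /= expansion_rec.
  case: (d 0%N) => /=; last first.
    by rewrite add0r leNgt E1 subr0.
  by rewrite lerDl E0; split=> //; rewrite addrC addKr.
elim: n c => [|n IH] c; first exact: (key c).2.
by rewrite digitsS (key c).1 IH.
Qed.

End Expansions.

Section BinaryExpansion.
Variable R : realType.
Implicit Types x : R.

Lemma digit_map2_bounds x : 0 <= x <= 1 -> 0 <= digit_map 2 x <= 1.
Proof.
rewrite /digit_map => /andP[x0 x1]; apply/andP.
by case: (leP 1 (2 * x)) => h /=; rewrite ?mulr1n ?mulr0n; split; lra.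
Qed.

Lemma partial_sum_digits x n :
  partial_sum 2 (digits 2 x) n = x - iter n (digit_map 2) x * 2^-1 ^+ n.
Proof.
elim: n x => [|n IH] x; first by rewrite /= expr0 mulr1 subrr.
rewrite [LHS]/= [X in partial_sum _ X](_ : _ = digits 2 (digit_map 2 x)).
  rewrite IH iterSr exprS /digits /= {1}/digit_map.
  by field.
by apply/funext => i; rewrite digitsS.
Qed.

Lemma expansion_digits x : 0 <= x <= 1 -> expansion 2 (digits 2 x) = x.
Proof.
move=> x01; have h1 := @cvg_expansion R 2 (lexx _) (digits 2 x).
suff h2 : partial_sum 2 (digits 2 x) @ \oo --> x by exact: cvg_unique h1 h2.
have it n : 0 <= iter n (digit_map 2) x <= 1.
  by elim: n => // n; exact: digit_map2_bounds.
rewrite (_ : partial_sum _ _ = fun n => x - iter n (digit_map 2) x * 2^-1 ^+ n).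
  rewrite -[X in _ --> X]subr0; apply: cvgB; first exact: cvg_cst.
  apply: (@squeeze_cvgr _ _ _ _ (cst 0) (fun n => 2^-1 ^+ n)).
  - near=> n; have /andP[h0 hl] := it n; rewrite mulr_ge0 ?exprn_ge0 //=.
    by rewrite -[leRHS]mul1r ler_wpM2r // exprn_ge0.
  - exact: cvg_cst.
  - apply: cvg_expr; rewrite ger0_norm // invf_lt1 //; lra.
by apply/funext => n; exact: partial_sum_digits.
Unshelve. all: by end_near. Qed.

End BinaryExpansion.

(** * Fair coins *)

Section CoinSpace.
Variable I : eqType.

(** The sequences of coins with the finitely many prescribed values [L]. *)
Definition cylinder (L : seq (I * bool)) : set (I -> bool) :=
  [set w | all (fun l => w l.1 == l.2) L].

(** The space of families of coins indexed by [I], with the sigma-algebra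
    generated by the cylinders. *)
Definition coins := g_sigma_algebraType (range cylinder).

HB.instance Definition _ := Measurable.on coins.

Lemma measurable_cylinder L : measurable (cylinder L : set coins).
Proof. by apply: sub_sigma_algebra; exists L. Qed.

Lemma measurable_coin i : measurable_fun setT (fun w : coins => w i).
Proof.
move=> _; apply: (measurable_fun_bool true) => //.
rewrite setTI (_ : _ @^-1` _ = cylinder [:: (i, true)]).
  exact: measurable_cylinder.
by apply/seteqP; split=> w; rewrite /cylinder /= andbT => /eqP.
Qed.

Lemma measurable_to_coins d (T : measurableType d) (f : T -> coins) :
  (forall i, measurable_fun setT (fun t => f t i)) -> measurable_fun setT f.
Proof.
move=> mf; refine (@measurability _ _ T coins setT f (range cylinder) _ _) => //.
move=> _ [_ [L _ <-] <-]; rewrite setTI.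
elim: L => [|l L IH].
  by rewrite (_ : _ @^-1` _ = setT) //; exact/seteqP.
rewrite (_ : _ @^-1` _ = (fun t => f t l.1) @^-1` [set l.2] `&` f @^-1` cylinder L).
  by apply: measurableI => //; rewrite -[X in measurable X]setTI; exact: mf.
apply/seteqP; split=> t; rewrite /cylinder /=; first by move=> /andP[/eqP].
by move=> [-> ->]; rewrite eqxx.
Qed.

(** Repeated constraints of a cylinder are either redundant or
    contradictory. *)
Lemma cylinder_uniq L : cylinder L = set0 \/
  exists L', uniq (map fst L') /\ cylinder L = cylinder L'.
Proof.
elim: L => [|[i b] L [L0|[L' [uL' e]]]].
- by right; exists [::].
- left; rewrite -subset0 -L0 => w; rewrite /cylinder /=; by move=> /andP[].
have eL w : all (fun l => w l.1 == l.2) L = all (fun l => w l.1 == l.2) L'.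
  have [h1 h2] : cylinder L w <-> cylinder L' w by rewrite e.
  by apply/idP/idP.
have [iL|iL] := boolP (i \in map fst L'); last first.
  right; exists ((i, b) :: L'); split; first by rewrite /= iL.
  by apply/seteqP; split=> w; rewrite /cylinder /= eL.
move: iL => /mapP[[j b'] jL /= ->].
have wj w : all (fun l => w l.1 == l.2) L' -> w j = b'.
  by move=> /allP/(_ _ jL)/eqP.
have [->|bb] := eqVneq b b'.
  right; exists L'; split=> //; apply/seteqP; split=> w; rewrite /cylinder /= eL.
    by move=> /andP[].
  by move=> h; rewrite h (wj _ h) eqxx.
left; rewrite -subset0 => w; rewrite /cylinder /= eL => /andP[/eqP wb /wj e'].
by rewrite -wb e' eqxx in bb.
Qed.

End CoinSpace.

(** The push-forward, with its structure of measure. *)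
Definition image_measure d1 d2 (T1 : measurableType d1) (T2 : measurableType d2)
    (R : realFieldType) (m : {measure set T1 -> \bar R}) (f : T1 -> T2)
    (mf : measurable_fun setT f) : {measure set T2 -> \bar R} :=
  measure_function_pushforward__canonical__measure_function_Measure m mf.

Section UniformMeasure.
Variable R : realType.

Lemma measurable_unit : measurable (`[0, 1[ : set (measurableTypeR R)).
Proof. exact: measurable_itv. Qed.

(** The uniform probability on the half-open unit interval. *)
Definition uniform01 : set (measurableTypeR R) -> \bar R :=
  mrestr lebesgue_measure measurable_unit.

HB.instance Definition _ := Measure.on uniform01.

Lemma uniform01_setT : uniform01 setT = 1%E.
Proof.
rewrite /uniform01 /mrestr setTI lebesgue_measure_itv /= lte_fin ltr01.
by rewrite oppr0 adde0.
Qed.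

HB.instance Definition _ := Measure_isProbability.Build _ _ _
  uniform01 uniform01_setT.

Lemma lebesgue_measure_half (c : R) (A : set (measurableTypeR R)) :
  measurable A ->
  lebesgue_measure ((fun x : R => 2 * x - c) @^-1` A) =
  (2^-1%:E * lebesgue_measure A)%E.
Proof.
pose h (x : measurableTypeR R) : measurableTypeR R := 2 * x - c.
have mh : measurable_fun setT h.
  by apply: measurable_funB => //; exact: measurable_funM.
pose m := mscale (NngNum (ler0n R 2)) (image_measure lebesgue_measure mh).
have mE B : measurable B ->
    lebesgue_measure B = (2%:E * lebesgue_measure (h @^-1` B))%E.
  rewrite -[RHS]/(m B).
  apply: lebesgue_measure_unique => _ [[x y] _ <-].
  rewrite -[RHS]/(2%:E * lebesgue_measure (h @^-1` `]x, y]))%E.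
  rewrite (_ : h @^-1` _ = `](x + c) / 2, (y + c) / 2]%classic); last first.
    apply/seteqP; split=> t; rewrite /h /= !in_itv /= => /andP[? ?];
      by apply/andP; split; lra.
  rewrite !lebesgue_measure_itv /= !lte_fin ltr_pM2r ?invr_gt0 // ltrD2r.
  case: ltP => _; last by rewrite mule0.
  by rewrite -!EFinB -EFinM; congr (_%:E); field.
move=> mA; rewrite [in RHS]mE // muleA -EFinM mulVf //.
by rewrite mul1e.
Qed.

Lemma measurable_digit_map (b : R) :
  measurable_fun setT (digit_map b : measurableTypeR R -> measurableTypeR R).
Proof.
have mb : measurable_fun setT (fun x : measurableTypeR R => b * x).
  exact: measurable_funM.
apply: measurable_funB => //.
rewrite (_ : (fun x => _) =
  (fun x : measurableTypeR R => if 1 <= b * x then 1 else 0 : R)).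
  apply: measurable_fun_ifT => //; exact: measurable_fun_ler.
by apply/funext => x; case: (_ <= _).
Qed.

Lemma measurable_digits (b : R) n :
  measurable_fun setT (fun x : measurableTypeR R => digits b x n).
Proof.
apply: measurable_fun_ler => //; apply: measurable_funM => //.
elim: n => [|n IH]; first exact: measurable_id.
exact: (measurableT_comp (@measurable_digit_map b) IH).
Qed.

(** The two branches of the doubling map are affine of slope 2. *)
Lemma uniform01_branch (b : bool) (A : set (measurableTypeR R)) :
  measurable A ->
  uniform01 ([set x | digits 2 x 0 = b] `&` digit_map 2 @^-1` A) =
  (2^-1%:E * uniform01 A)%E.
Proof.
move=> mA; rewrite /uniform01 /mrestr -(lebesgue_measure_half b%:R); last first.
  exact: measurableI.
congr lebesgue_measure; apply/seteqP; split=> x /=; rewrite /digits /digit_map /=.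
  move=> [[hb Ax]]; rewrite ?in_itv /= => /andP[x0 x1]; rewrite hb in Ax.
  split=> //; rewrite ?in_itv /=; apply/andP.
  by case: b hb {Ax} => /= [h|/negbT]; rewrite -?ltNge; split; lra.
move=> [Ax]; rewrite ?in_itv /= => /andP[h0 h1].
have hb : (1 <= 2 * x) = b.
  by case: b h0 h1 {Ax} => /= h0 h1; [|apply/negbTE; rewrite -ltNge]; lra.
split; first by rewrite hb.
by case: b h0 h1 {Ax hb} => /= h0 h1; apply/andP; split; lra.
Qed.

Lemma uniform01_digit_map (A : set (measurableTypeR R)) :
  measurable A -> uniform01 (digit_map 2 @^-1` A) = uniform01 A.
Proof.
move=> mA; pose D b := [set x : R | digits 2 x 0 = b].
have mD b : measurable (D b `&` digit_map 2 @^-1` A).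
  apply: measurableI; rewrite -[X in measurable X]setTI.
    exact: (@measurable_digits 2 0 measurableT [set b]).
  exact: measurable_digit_map.
rewrite (_ : _ @^-1` A = (D true `&` digit_map 2 @^-1` A) `|`
    (D false `&` digit_map 2 @^-1` A)); last first.
  rewrite -setIUl (_ : D true `|` D false = setT) ?setTI //.
  by apply/seteqP; split=> // x _; rewrite /D /=; case: digits; [left|right].
rewrite measureU; [|exact: mD|exact: mD|]; last first.
  by apply/seteqP; split=> // x [[+ _] [+ _]]; rewrite /D /= => ->.
transitivity (2^-1%:E * uniform01 A + 2^-1%:E * uniform01 A)%E.
  by congr (_ + _)%E; exact: uniform01_branch.
rewrite -ge0_muleDl ?lee_fin ?invr_ge0 //.
by rewrite -EFinD (_ : _ + _ = 1) ?mul1e //; field.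
Qed.

Lemma measurable_digit_cylinder (L : seq (nat * bool)) :
  measurable ([set x | all (fun l => digits 2 x l.1 == l.2) L] :
    set (measurableTypeR R)).
Proof.
have := measurable_to_coins (f := digits 2 : measurableTypeR R -> coins nat)
  (@measurable_digits 2).
by move=> /(_ measurableT _ (measurable_cylinder L)); rewrite setTI.
Qed.

(** The binary digits are independent and fair.  The induction removes the
    constraint on the digit 0, if any, and applies the doubling map. *)
Lemma uniform01_cylinder (L : seq (nat * bool)) : uniq (map fst L) ->
  uniform01 [set x | all (fun l => digits 2 x l.1 == l.2) L] =
  (2^-1 ^+ size L)%:E.
Proof.
have [N] := ubnP (\sum_(l <- L) l.1.+1)%N; elim: N L => // N IH L.
case: L => [|l0 L]; first move=> _ _.
  rewrite expr0 (_ : [set _ | _] = setT) ?uniform01_setT //.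
  exact/seteqP.
have : (0 < size (l0 :: L))%N by [].
move: (l0 :: L) => {l0 L} K K0 sN uK.
pose shift := map (fun l : nat * bool => (l.1.-1, l.2)).
have shiftE K' : 0%N \notin map fst K' ->
    [set x : R | all (fun l => digits 2 x l.1 == l.2) K'] =
    digit_map 2 @^-1` [set x | all (fun l => digits 2 x l.1 == l.2) (shift K')].
  move=> n0; apply/seteqP; split=> x /=; rewrite all_map => h;
    apply/allP => -[[|i] b] lK; move: (allP h _ lK); rewrite /= ?digitsS //.
  - by case/mapP: n0; exists (0%N, b).
  - by case/mapP: n0; exists (0%N, b).
have shift_uniq K' : 0%N \notin map fst K' -> uniq (map fst K') ->
    uniq (map fst (shift K')).
  move=> n0 uK'; rewrite -map_comp (_ : _ \o _ = predn \o fst) // map_comp.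
  rewrite map_inj_in_uniq // => i j iK jK.
  by case: i j iK jK => [|i] [|j] //= iK jK => [|/esym|->] //; rewrite ?iK ?jK in n0.
have shift_sum K' : 0%N \notin map fst K' ->
   (\sum_(l <- shift K') l.1.+1 + size K' <= \sum_(l <- K') l.1.+1)%N.
  elim: K' => [|[[|i] b] K' IHK] //=; first by rewrite big_nil.
  rewrite !inE !big_cons /= => /IHK h.
  by rewrite addnS -addnA -addSn leq_add2l.
have [n0|n0] := boolP (0%N \in map fst K); last first.
  rewrite shiftE // uniform01_digit_map ?IH ?size_map //.
  - rewrite -ltnS (leq_trans _ sN) // ltnS (leq_trans _ (shift_sum _ n0)) //.
    by rewrite -addn1 leq_add2l.
  - exact: shift_uniq.
  - exact: measurable_digit_cylinder.
case/mapP: n0 => -[i b] bK /= i0; rewrite -{i}i0 in bK.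
have pK := perm_to_rem bK.
have eK : [set x : R | all (fun l => digits 2 x l.1 == l.2) K] =
    [set x : R | digits 2 x 0 = b] `&`
    [set x : R | all (fun l => digits 2 x l.1 == l.2) (rem (0%N, b) K)].
  apply/seteqP; split=> x; rewrite /= (perm_all _ pK) /=; first by move=> /andP[/eqP].
  by move=> [-> ->]; rewrite eqxx.
have : uniq (map fst ((0%N, b) :: rem (0%N, b) K)).
  by rewrite -(perm_uniq (perm_map fst pK)).
move=> /andP[n0 ur]; rewrite eK shiftE // uniform01_branch.
  rewrite IH ?shift_uniq //.
    by rewrite size_map -EFinM -exprS (perm_size pK).
  move: sN; rewrite (perm_big _ pK) big_cons /= add1n !ltnS; apply: leq_trans.
  by rewrite ltnS (leq_trans _ (shift_sum _ n0)) // leq_addr.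
exact: measurable_digit_cylinder.
Qed.

End UniformMeasure.

Section CoinMeasure.
Variables (R : realType) (I : eqType) (e : I -> nat).

(** The coin of index [i] is the binary digit of index [e i]. *)
Definition coding (x : measurableTypeR R) : coins I := fun i => digits 2 x (e i).

Lemma measurable_coding : measurable_fun setT coding.
Proof. by apply: measurable_to_coins => i; exact: measurable_digits. Qed.

(** The law of the family of binary digits read at the places [e i]: when [e]
    is injective, that of independent fair coins indexed by [I]. *)
Definition coin_measure : set (coins I) -> \bar R :=
  image_measure (@uniform01 R) measurable_coding.

HB.instance Definition _ := Measure.on coin_measure.

Lemma coin_measure_setT : coin_measure setT = 1%E.
Proof. exact: uniform01_setT. Qed.

HB.instance Definition _ := Measure_isProbability.Build _ _ _
  coin_measure coin_measure_setT.

Hypothesis e_inj : injective e.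

Lemma coin_measure_cylinder (L : seq (I * bool)) : uniq (map fst L) ->
  coin_measure (cylinder L) = (2^-1 ^+ size L)%:E.
Proof.
move=> uL; rewrite -(size_map (fun l => (e l.1, l.2))) -uniform01_cylinder.
  congr uniform01; apply/seteqP; split=> x; by rewrite /cylinder /= all_map.
by rewrite -map_comp (_ : _ \o _ = e \o fst) // map_comp map_inj_uniq.
Qed.

Lemma coin_measure_shift (s : I -> I) : injective s ->
  forall A, measurable A ->
    coin_measure ((fun w : coins I => w \o s : coins I) @^-1` A) = coin_measure A.
Proof.
move=> s_inj A mA.
have ms : measurable_fun setT (fun w : coins I => w \o s : coins I).
  by apply: measurable_to_coins => i; exact: measurable_coin.
rewrite -[LHS]/(image_measure coin_measure ms A).
apply: (@measure_unique _ R (coins I) (range (@cylinder I)) (fun=> setT)) => //.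
- move=> _ _ [L1 _ <-] [L2 _ <-]; exists (L1 ++ L2) => //.
  by apply/seteqP; split=> w; rewrite /cylinder /= all_cat => /andP.
- by move=> _; exists [::] => //; apply/seteqP; split.
- by apply/seteqP; split=> // w _; exists 0%N.
- move=> _ [L _ <-].
  have [->|[L' [uL' ->]]] := cylinder_uniq L; first by rewrite !measure0.
  rewrite [RHS]coin_measure_cylinder //.
  rewrite -(size_map (fun l => (s l.1, l.2))) -coin_measure_cylinder.
    congr coin_measure; apply/seteqP; split=> w; by rewrite /cylinder /= all_map.
  by rewrite -map_comp (_ : _ \o _ = s \o fst) // map_comp map_inj_uniq.
- by move=> _; rewrite -[X in (X < _)%E]/(coin_measure setT) coin_measure_setT ltry.
Qed.

(** The families of coins that agree along all the pairs of [P]. *)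
Definition agree (P : seq (I * I)) : set (I -> bool) :=
  [set w | all (fun p => w p.1 == w p.2) P].

Lemma measurable_agree P : measurable (agree P : set (coins I)).
Proof.
elim: P => [|[i j] P IH].
  by rewrite (_ : agree _ = setT) //; exact/seteqP.
rewrite (_ : agree _ = (cylinder [:: (i, true); (j, true)] `|`
  cylinder [:: (i, false); (j, false)]) `&` agree P).
  by apply: measurableI => //; apply: measurableU; exact: measurable_cylinder.
apply/seteqP; split=> w; rewrite /agree /cylinder /= !andbT.
  by move=> /andP[/eqP -> aP]; split=> //; case: (w j); [left|right].
by move=> [[|] /andP[/eqP -> /eqP ->] ->].
Qed.

(** Each pair of fresh indices on which the coins agree halves the measure. *)
Lemma coin_measure_agree L P :
  uniq (map fst L ++ map fst P ++ map snd P) ->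
  coin_measure (cylinder L `&` agree P) = (2^-1 ^+ (size L + size P))%:E.
Proof.
elim: P L => [|[i j] P IH] L.
  rewrite /= !cats0 addn0 => uL; rewrite -coin_measure_cylinder //.
  by congr coin_measure; apply/seteqP; split=> // w [].
move=> u; have ub b : uniq (map fst [:: (i, b), (j, b) & L] ++
    map fst P ++ map snd P).
  rewrite -(perm_uniq (s1 := map fst L ++ map fst ((i, j) :: P) ++
    map snd ((i, j) :: P))) //.
  by apply/permP => a; rewrite /= !count_cat /= !count_cat /=; lia.
pose C b := cylinder [:: (i, b), (j, b) & L] `&` agree P : set (coins I).
have mC b : measurable (C b).
  by apply: measurableI; [exact: measurable_cylinder|exact: measurable_agree].
rewrite (_ : _ `&` _ = C true `|` C false); last first.
  apply/seteqP; split=> w; rewrite /C /agree /cylinder /=.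
    move=> [cL /andP[/eqP -> aP]].
    by case: (w j); [left|right]; rewrite !eqxx.
  by move=> [|] [/and3P[/eqP -> /eqP -> ->] ->].
rewrite measureU; [|exact: mC|exact: mC|]; last first.
  by apply/seteqP; split=> // w; rewrite /C /cylinder /= =>
    -[[/andP[/eqP -> _] _] [/andP[]]].
transitivity ((2^-1 ^+ (size L + size P).+2)%:E + (2^-1 ^+ (size L + size P).+2)%:E : \bar R)%E.
  by congr (_ + _)%E; exact: IH.
by rewrite -EFinD /= addnS; congr (_%:E); rewrite !exprS; field.
Qed.

End CoinMeasure.

(** Two disjoint infinite blocks of coins almost surely differ. *)
Lemma coin_shift_fix_null (R : realType) (G : eqType) (e : G * nat -> nat) (g h : G) :
  injective e -> g <> h ->
  let A := [set w : coins (G * nat)%type | forall i, w (g, i) = w (h, i)] in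
  measurable A /\ coin_measure R e A = 0%E.
Proof.
move=> e_inj gh A.
pose P n := [seq ((g, i), (h, i)) | i <- iota 0 n].
have AP : A = \bigcap_n agree (P n).
  apply/seteqP; split=> w Aw.
    move=> n _; rewrite /agree /= all_map; apply/allP => i _ /=; apply/eqP; exact: Aw.
  move=> i; have /allP Awi : all (fun k => w (g, k) == w (h, k)) (iota 0 i.+1).
    by have : agree (P i.+1) w := Aw i.+1 Logic.I; rewrite /agree /mkset all_map.
  by apply/eqP/(Awi i); rewrite mem_iota add0n ltnS leqnn.
have mA : measurable (A : set (coins _)).
  by rewrite AP; apply: bigcapT_measurable => n; exact: measurable_agree.
have le n : (coin_measure R e A <= (2^-1 ^+ n)%:E)%E.
  have -> : (2^-1 ^+ n)%:E = coin_measure R e (cylinder [::] `&` agree (P n)).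
    rewrite coin_measure_agree //= ?add0n ?size_map ?size_iota //.
    rewrite -!map_comp cat_uniq !map_inj_uniq ?iota_uniq ?andbT /=; last 2 first.
    - by move=> i j [].
    - by move=> i j [].
    by apply/hasPn => _ /mapP[i _ ->]; apply/mapP => -[j _ [/esym]].
  apply: le_measure; rewrite ?inE //.
    by apply: measurableI; [exact: measurable_cylinder|exact: measurable_agree].
  by move=> w; rewrite AP => Aw; split=> //; exact: Aw.
split=> //; apply/eqP; rewrite eq_le measure_ge0 andbT.
have cv : (fun n => (2^-1 ^+ n)%:E : \bar R) @ \oo --> 0%E.
  apply: cvg_EFin; first by near=> n.
  by apply: cvg_expr; rewrite ger0_norm // invf_lt1 //; lra.
rewrite -(cvg_lim _ cv) //; apply: lime_ge; first by apply: cvgP cv.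
by near=> n; exact: le.
Unshelve. all: by end_near. Qed.

(** * Standard Borel spaces *)

Section StandardBorel.
Variables (R : realType) (d : measure_display) (T : measurableType d).

(** A measurable retract of the line is standard Borel: its image is the
    fixed-point set of a measurable map. *)
Lemma standard_borel_of_retract (f : T -> R) (r : R -> T) :
  measurable_fun setT f -> measurable_fun setT r -> cancel f r ->
  (forall x, 0 <= f x <= 1) -> standard_borel R T.
Proof.
move=> mf mr fK f01; pose B := [set y | f (r y) = y].
have mB : measurable B.
  have : measurable_fun setT (fun y => f (r y) == y).
    by apply: measurable_fun_eqr => //; exact: measurableT_comp.
  move=> /(_ measurableT [set true] Logic.I); rewrite setTI.
  by rewrite (_ : _ @^-1` _ = B) //; apply/seteqP; split=> y /= /eqP.
have rangeE C : f @` C = B `&` r @^-1` C.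
  apply/seteqP; split=> [_ [x Cx <-]|y [By Cy]].
    by rewrite /B /= !fK.
  by exists (r y).
exists B, f; split; first by move=> y <-; rewrite /= in_itv /=.
split=> //.
- split=> //; first by move=> x _; rewrite /B /= fK.
    by move=> x y _ _ /(can_inj fK).
  by move=> y By; exists (r y).
- move=> C mC _; rewrite rangeE; apply: measurableI => //.
  by rewrite -[X in measurable X]setTI; exact: mr.
Qed.

Lemma retract_of_standard_borel : standard_borel R T ->
  exists (f : T -> R) (r : R -> T),
    [/\ measurable_fun setT f, measurable_fun setT r, cancel f r &
        forall x, 0 <= f x <= 1].
Proof.
move=> [B [f [B01 [_ mB [fB finj fsurj] mf mfC]]]].
pose P y x := f x = y.
pose r y := xget point (P y).
have fK : cancel f r.
  move=> x; rewrite /r; have Pr := @xgetPex _ point (P (f x)) (ex_intro _ x erefl).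
  by apply: finj; rewrite ?inE.
exists f, r; split=> //; last first.
  by move=> x; have := B01 _ (fB x Logic.I); rewrite /= in_itv.
move=> _ C mC; rewrite setTI.
have rE y : ~ B y -> r y = point.
  by move=> nBy; rewrite /r xgetPN // => x e; apply: nBy; rewrite -e; exact: fB.
have mfC' := mfC _ mC (@subsetT _ _).
have [Cp|nCp] := pselect (C point).
  rewrite (_ : _ @^-1` _ = f @` C `|` ~` B).
    by apply: measurableU => //; exact: measurableC.
  apply/seteqP; split=> y /=.
    have [By|nBy] := pselect (B y); last by right.
    by have [x _ <-] := fsurj _ By; rewrite fK => Cx; left; exists x.
  by move=> [[x Cx <-]|/rE ->] //; rewrite fK.
rewrite (_ : _ @^-1` _ = f @` C) //.
apply/seteqP; split=> y /=; last by move=> [x Cx <-]; rewrite fK.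
have [By|/rE ->//] := pselect (B y).
by have [x _ <-] := fsurj _ By; rewrite fK => Cx; exists x.
Qed.

Lemma measurable_diagonal : standard_borel R T ->
  measurable [set xy : T * T | xy.1 = xy.2].
Proof.
move=> /retract_of_standard_borel[f [r [mf _ fK _]]].
have : measurable_fun setT (fun xy : T * T => f xy.1 == f xy.2).
  by apply: measurable_fun_eqr; apply: (measurableT_comp mf);
    [exact: measurable_fst|exact: measurable_snd].
move=> /(_ measurableT [set true] Logic.I); rewrite setTI.
rewrite (_ : _ @^-1` _ = [set xy : T * T | xy.1 = xy.2]) //.
apply/seteqP; split=> -[x y] /=; first by move=> /eqP/(can_inj fK).
by move=> ->; apply/eqP.
Qed.

End StandardBorel.

Lemma measurable_partial_sum (R : realType) (b : R) d (T : measurableType d)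
    (g : T -> nat -> bool) n :
  (forall i, measurable_fun setT (g ^~ i)) ->
  measurable_fun setT (fun t => partial_sum b (g t) n).
Proof.
elim: n g => [|n IH] g mg; first exact: measurable_cst.
apply: measurable_funM; last exact: measurable_cst.
apply: measurable_funD; last by apply: (IH (fun t i => g t i.+1)) => i; exact: mg.
rewrite (_ : (fun t => _) = fun t => if g t 0%N then 1 else 0 : R).
  by apply: measurable_fun_ifT.
by apply/funext => t; case: (g t 0%N).
Qed.

Lemma measurable_expansion (R : realType) (b : R) d (T : measurableType d)
    (g : T -> nat -> bool) : 2 <= b ->
  (forall i, measurable_fun setT (g ^~ i)) ->
  measurable_fun setT (fun t => expansion b (g t)).
Proof.
move=> b2 mg; apply: (measurable_fun_cvg (h := fun n t => partial_sum b (g t) n)).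
  by move=> n; exact: measurable_partial_sum.
by move=> t _; exact: cvg_expansion.
Qed.

(** The binary digits of the point of [T] and the coins are interleaved, at
    the even and the odd places, and the result is coded in base 3. *)
Lemma standard_borel_prod_coins (R : realType) d (T : measurableType d)
    (I : eqType) (e : I -> nat) :
  injective e -> standard_borel R T -> standard_borel R (T * coins I)%type.
Proof.
move=> e_inj /retract_of_standard_borel[f [r [mf mr fK f01]]].
pose mix (xw : T * coins I) (n : nat) : bool :=
  if odd n then `[< exists2 i, e i = n./2 & xw.2 i >] else digits 2 (f xw.1) n./2.
pose F xw : R := expansion 3 (mix xw).
pose unmix (y : R) : T * coins I :=
  (r (expansion 2 (fun n => digits 3 y n.*2)), fun i => digits 3 y (e i).*2.+1).
have b3 : (2 : R) <= 3 by lra.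
apply: (@standard_borel_of_retract _ _ _ F unmix).
- apply: measurable_expansion => // n; rewrite /mix; case: (odd n).
    have [[i ei]|ne] := pselect (exists i, e i = n./2).
      rewrite (_ : (fun xw => _) = fun xw : T * coins I => xw.2 i).
        exact: (measurableT_comp (@measurable_coin _ i) (@measurable_snd _ _ _ _)).
      apply/funext => -[x w] /=; apply/asboolP/idP => [[j ej wj]|wi].
        by rewrite -(e_inj j i) // ei.
      by exists i.
    rewrite (_ : (fun xw => _) = fun=> false) //.
    by apply/funext => xw; apply/asboolP => -[i ei _]; apply: ne; exists i.
  apply: (measurableT_comp (@measurable_digits R 2 n./2)).
  exact: (measurableT_comp mf (@measurable_fst _ _ _ _)).
- apply/measurable_fun_pairP; split.
    apply: (measurableT_comp mr); apply: measurable_expansion => // n.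
    exact: measurable_digits.
  by apply: measurable_to_coins => i; exact: measurable_digits.
- move=> [x w]; rewrite /unmix /F digits_expansion //; last by lra.
  congr pair.
    rewrite -[RHS]fK -(expansion_digits (f01 x)); congr (r (expansion 2 _)).
    by apply/funext => n; rewrite /mix odd_double doubleK.
  apply/funext => i; rewrite /mix /= odd_double /= uphalf_double.
  by apply/asboolP/idP => [[j /e_inj -> //]|wi]; exists i.
- move=> xw; have /andP[-> h] := expansion_bounds b3 (mix xw).
  apply: (le_trans h); rewrite invf_le1; lra.
Qed.

Local Close Scope ring_scope.

(** * Measurable actions of countable groups *)

Section Action.
Variables (G : groupType) (T : Type) (act : G -> T -> T).
Hypothesis act1 : forall x, act 1%g x = x.
Hypothesis actM : forall g h x, act (g * h)%g x = act g (act h x).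

Lemma actK g x : act g^-1%g (act g x) = x.
Proof. by rewrite -actM mulVg act1. Qed.

Lemma actVK g x : act g (act g^-1%g x) = x.
Proof. by rewrite -actM mulgV act1. Qed.

Lemma image_act g C : act g @` C = act g^-1%g @^-1` C.
Proof.
apply/seteqP; split=> [_ [x Cx <-]|x Cx]; first by rewrite /preimage /= actK.
by exists (act g^-1%g x) => //; rewrite actVK.
Qed.

End Action.

Section Orbits.
Variables (G : groupType) (d : measure_display) (T : measurableType d).
Variables (act : G -> T -> T) (enum : nat -> G).
Hypothesis enum_surj : forall g, exists n, enum n = g.
Hypothesis mact : forall g, measurable_fun setT (act g).
Hypothesis mdiag : measurable [set xy : T * T | xy.1 = xy.2].

Lemma bigcup_group (U : Type) (A : G -> set U) :
  [set u | exists g, A g u] = \bigcup_n A (enum n).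
Proof.
apply/seteqP; split=> [u [g Ag]|u [n _ An]]; last by exists (enum n).
by have [n en] := enum_surj g; exists n => //; rewrite en.
Qed.

(** A union, over the countable group, of pieces of graphs. *)
Lemma measurable_orbit_pairs (P : G -> set (T * T)) :
  (forall g, measurable (P g)) ->
  measurable [set xy : T * T | exists g, P g xy /\ act g xy.1 = xy.2].
Proof.
move=> mP; rewrite (bigcup_group (fun g => [set xy | P g xy /\ act g xy.1 = xy.2])).
apply: bigcup_measurable => n _; set g := enum n.
apply: (@measurableI _ _ (P g) [set xy | act g xy.1 = xy.2]) => //.
have mf : measurable_fun setT (fun xy : T * T => (act g xy.1, xy.2)).
  apply: measurable_fun_pair; last exact: measurable_snd.
  exact: (measurableT_comp (mact g) (@measurable_fst _ _ _ _)).
by have := mf measurableT _ mdiag; rewrite setTI.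
Qed.

Lemma measurable_orbit_rel (H : set G) : measurable (orbit_rel act H).
Proof.
rewrite (_ : orbit_rel act H =
  [set xy | exists g, [set _ | H g] xy /\ act g xy.1 = xy.2]).
  apply: measurable_orbit_pairs => g.
  have [Hg|nHg] := pselect (H g).
    suff -> : [set _ : T * T | H g] = setT by exact: measurableT.
    by apply/seteqP; split.
  suff -> : [set _ : T * T | H g] = set0 by exact: measurable0.
  by apply/seteqP; split.
by apply/seteqP; split=> xy [g]; [exists g|move=> [Hg e]; exists g].
Qed.

Lemma measurable_chain_closure (E : set (T * T)) :
  measurable E -> E `<=` orbit_rel act setT -> measurable (chain_closure E).
Proof.
move=> mE Eorb.
rewrite (_ : chain_closure E =
  \bigcup_n [set xy | chain (rel_of E) n xy.1 xy.2]); last first.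
  by apply/seteqP; split=> xy [n]; [exists n|move=> _ ?; exists n].
apply: bigcup_measurable => n _; elim: n => [|n IH].
  rewrite (_ : [set _ | _] = [set xy : T * T | xy.1 = xy.2]) //.
  apply/seteqP; split=> -[x y] /=; first by move=> ch; inversion ch.
  by move=> ->; exact: chain0.
rewrite (_ : [set _ | _] = [set xy : T * T | exists g,
    E (xy.1, act g xy.1) /\ chain (rel_of E) n (act g xy.1) xy.2]); last first.
  apply/seteqP; split=> -[x y] /=.
    move=> ch; inversion ch as [|n' x' z y' Exz chz]; subst.
    by have [g _ /= e] := Eorb _ Exz; exists g; rewrite e.
  by move=> [g [Eg ch]]; exact: chainS ch.
rewrite (bigcup_group (fun g => [set xy : T * T |
    E (xy.1, act g xy.1) /\ chain (rel_of E) n (act g xy.1) xy.2])).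
apply: bigcup_measurable => m _; set g := enum m.
have mg : measurable_fun setT (fun xy : T * T => act g xy.1).
  exact: (measurableT_comp (mact g) (@measurable_fst _ _ _ _)).
apply: (@measurableI _ _ [set xy | E (xy.1, act g xy.1)]
  [set xy | chain (rel_of E) n (act g xy.1) xy.2]).
  have mf : measurable_fun setT (fun xy : T * T => (xy.1, act g xy.1)).
    by apply: measurable_fun_pair => //; exact: measurable_fst.
  by have := mf measurableT _ mE; rewrite setTI.
have mf : measurable_fun setT (fun xy : T * T => (act g xy.1, xy.2)).
  by apply: measurable_fun_pair => //; exact: measurable_snd.
by have := mf measurableT _ IH; rewrite setTI.
Qed.

Hypothesis act1 : forall x, act 1%g x = x.

Lemma borel_chain_closure (E : set (T * T)) :
  measurable E -> E `<=` orbit_rel act setT ->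
  (forall x y, E (x, y) -> E (y, x)) ->
  borel_equivalence (chain_closure E).
Proof.
move=> mE Eorb Esym; split.
- exact: measurable_chain_closure.
- by move=> x; exact: connected_refl.
- by move=> x y; apply: connected_sym; exact: Esym.
- by move=> x y z; exact: connected_trans.
Qed.

Hypothesis actM : forall g h x, act (g * h)%g x = act g (act h x).

Lemma borel_orbit_rel (H : set G) : subgroup H ->
  borel_equivalence (orbit_rel act H).
Proof.
move=> sH; split; first exact: measurable_orbit_rel.
- by move=> x; exists 1%g; [exact: subgroup1|exact: act1].
- move=> x y [g Hg /= <-]; exists g^-1%g; first exact: subgroupV.
  exact: (actK act1 actM).
- move=> x y z [g Hg /= <-] [h Hh /= <-]; exists (h * g)%g.
    exact: subgroupM.
  exact: actM.
Qed.

Lemma mp_borel_iso_act (R : realType) (mu : probability T R) g :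
  (forall h A, measurable A -> mu (act h @^-1` A) = mu A) ->
  mp_borel_iso mu setT setT (act g).
Proof.
move=> mpact; split; last by move=> C mC _; rewrite (image_act act1 actM) mpact.
split=> //.
- split=> //; first by move=> x y _ _ /(can_inj (actK act1 actM g)).
  by move=> y _; exists (act g^-1%g y) => //; exact: (actVK act1 actM).
- move=> C mC _; rewrite (image_act act1 actM) -[X in measurable X]setTI; exact: mact.
Qed.

Lemma mp_equivalence_orbit_rel (R : realType) (mu : probability T R) :
  (forall h A, measurable A -> mu (act h @^-1` A) = mu A) ->
  mp_equivalence mu (orbit_rel act setT).
Proof.
move=> mpact; exists [set Aphi | exists g, Aphi = (setT, act g)]; split.
  move=> _ _ [g [-> ->]]; rewrite (image_act act1 actM) preimage_setT.
  exact: mp_borel_iso_act.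
split.
- by apply: borel_orbit_rel; apply/subgroupP.
- by move=> [x y] [_ [_ [[g [-> ->]] _ /= ->]]]; exists g.
- move=> E' _ sub [x y] [g _ /= <-]; apply: sub.
  by exists setT, (act g); split=> //; exists g.
Qed.

(** The points whose orbit avoids a null set form an invariant conull set. *)
Lemma conull_invariant (R : realType) (mu : probability T R) (N : set T) :
  (forall h A, measurable A -> mu (act h @^-1` A) = mu A) ->
  measurable N -> mu N = 0%E ->
  measurable [set x | forall g, ~ N (act g x)] /\
  mu [set x | forall g, ~ N (act g x)] = 1%E.
Proof.
move=> mpact mN N0; set B := [set x | _].
have BC : B = ~` (\bigcup_n (act (enum n) @^-1` N)).
  by rewrite -(bigcup_group (fun g => act g @^-1` N)); apply/seteqP; split=> x /forallNP.
have mpre g : measurable (act g @^-1` N).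
  by rewrite -[X in measurable X]setTI; exact: mact.
have mU : measurable (\bigcup_n (act (enum n) @^-1` N)).
  by apply: bigcup_measurable.
have U0 : mu (\bigcup_n (act (enum n) @^-1` N)) = 0%E.
  apply: measure_negligible => //; apply: negligible_bigcup => n.
  by apply/negligibleP => //; exact: etrans (mpact _ _ mN) N0.
by rewrite BC; split; [exact: measurableC|rewrite probability_setC // U0 sube0].
Qed.

End Orbits.

(** * The two actions *)

Section Presentation.
Variables (n k : nat) (ord : 'I_k -> nat) (G : groupType).
Variables (a : 'I_n -> G) (s : 'I_k -> G).
Hypothesis presG : has_presentation (cyclic_relators n ord) (sum_fun a s).

Lemma generated_by_presentation (H : set G) : subgroup H ->
  (forall i, H (a i)) -> (forall j, H (s j)) -> forall g, H g.
Proof.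
move=> sH Ha Hs g; have [w <-] := presG.1 g.
elim: w => [|[x b] w IH]; first by rewrite eval_word_nil; exact: subgroup1.
rewrite eval_word_cons; apply: subgroupM => //=.
have Hx : H (sum_fun a s x) by case: x.
by case: b => //; exact: subgroupV.
Qed.

Lemma presentation_enum : exists enum : nat -> G, forall g, exists m, enum m = g.
Proof.
pose enum m := if @unpickle (seq (('I_n + 'I_k) * bool)) m is Some w
  then eval_word (sum_fun a s) w else 1%g.
exists enum => g; have [w ew] := presG.1 g.
by exists (pickle (w : seq (('I_n + 'I_k) * bool))); rewrite /enum pickleK.
Qed.

(** G is countable; [nat] leaves room for infinitely many coins per group
    element. *)
Lemma presentation_code : exists e : G * nat -> nat, injective e.
Proof.
pose c g : seq (('I_n + 'I_k) * bool) := projT1 (cid (presG.1 g)).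
have cK g : eval_word (sum_fun a s) (c g) = g := projT2 (cid (presG.1 g)).
exists (fun gi => pickle (c gi.1, gi.2)) => -[g i] [h j] /=.
move=> /(pcan_inj pickleK) [cgh ->]; congr pair.
by rewrite -(cK g) cgh cK.
Qed.

Variables (R : realType) (d : measure_display) (X : measurableType d).
Variables (mu : probability X R) (act0 : G -> X -> X).
Hypothesis pmp : pmp_action mu (subgroup_gen (range a)) act0.

Let F := subgroup_gen (range a).

(** The action of F extends to G by letting the [s j] act trivially. *)
Lemma extend_action : exists act : G -> X -> X,
  [/\ forall x, act 1%g x = x,
      forall g h x, act (g * h)%g x = act g (act h x),
      forall g x, F g -> act g x = act0 g x,
      forall g, measurable_fun setT (act g) &
      forall g A, measurable A -> mu (act g @^-1` A) = mu A].
Proof.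
have [act1 actM mpact] := pmp.
have sF : subgroup F := subgroup_genP _.
pose L (l : ('I_n + 'I_k) * bool) : X -> X :=
  if l.1 is inl i then act0 (if l.2 then (a i)^-1 else a i)%g else id.
have Fa i : F (a i) by apply: sub_subgroup_gen; exists i.
have FaV i : F (a i)^-1%g by exact: (subgroupV sF).
pose D (x : X) := True.
have LD l x : D x -> D (L l x) by [].
have LK y b x : D x -> L (y, b) (L (y, ~~ b) x) = x.
  case: y => //= i _; rewrite /L /=; case: b => /=.
    by rewrite -(actM _ _ x (FaV i) (Fa i)) mulVg act1.
  by rewrite -(actM _ _ x (Fa i) (FaV i)) mulgV act1.
have Lrel r x : cyclic_relators n ord r -> D x -> foldr L x r = x.
  by move=> [j ->] _; elim: (ord j).
have act0M g : F g -> measurable_fun setT (act0 g) /\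
    forall A, measurable A -> mu (act0 g @^-1` A) = mu A.
  move=> Fg; have [[_ _ _ mg _] mug] := mpact g Fg; split=> // A mA.
  have mgA : measurable (act0 g @^-1` A).
    by rewrite -[X in measurable X]setTI; exact: mg.
  rewrite -(mug _ mgA (@subsetT _ _)); congr (mu _).
  apply/seteqP; split=> [_ [x Ax <-] //|x Ax].
  have FgV : F g^-1%g by exact: (subgroupV sF).
  exists (act0 g^-1%g x); rewrite /preimage /= -actM // mulgV act1 //.
have mpL l : measurable_fun setT (L l) /\
    forall A, measurable A -> mu (L l @^-1` A) = mu A.
  by case: l => -[i|j] b; rewrite /L //=; apply: act0M; case: b.
exists (pact presG L); split.
- by move=> x; exact: (pact1 presG LD LK Lrel).
- by move=> g h x; exact: (pactM presG LD LK Lrel).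
- move=> g x Fg; apply: (pact_eqP LD LK Lrel (act := act0)) Fg Logic.I => //.
    by move=> g' h' x' Fg' Fh' _; exact: actM.
  by move=> _ y [i _ <-] _; exact: (pact_gen presG LD LK Lrel (inl i)).
- move=> g; rewrite /pact; elim: (projT1 _) => [|l w IH] /=.
    exact: measurable_id.
  exact: (measurableT_comp (mpL l).1 IH).
- move=> g A mA; rewrite /pact; elim: (projT1 _) A mA => [|l w IH] A mA //=.
  rewrite -[RHS](mpL l).2 // -[RHS]IH //.
  by rewrite -[X in measurable X]setTI; exact: (mpL l).1.
Qed.

End Presentation.

Section CoinAction.
Variables (R : realType) (G : groupType) (e : G * nat -> nat).
Hypothesis e_inj : injective e.
Local Notation W := (coins (G * nat)%type).

(** The shift of G on the first coordinate of the indices. *)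
Definition coin_shift (g : G) (w : W) : W := fun x => w ((g^-1 * x.1)%g, x.2).

Lemma coin_shift1 w : coin_shift 1%g w = w.
Proof. by apply/funext => -[x i]; rewrite /coin_shift invg1 mul1g. Qed.

Lemma coin_shiftM g h w : coin_shift (g * h)%g w = coin_shift g (coin_shift h w).
Proof. by apply/funext => -[x i]; rewrite /coin_shift /= invgM mulgA. Qed.

Lemma measurable_coin_shift g : measurable_fun setT (coin_shift g).
Proof. by apply: measurable_to_coins => i; exact: measurable_coin. Qed.

Lemma coin_shift_mp g A : measurable A ->
  coin_measure R e (coin_shift g @^-1` A) = coin_measure R e A.
Proof.
move=> mA; apply: (coin_measure_shift R e_inj
  (s := fun x : G * nat => ((g^-1 * x.1)%g, x.2))) => //.
by move=> [x i] [y j] [/mulgI -> ->].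
Qed.

(** A family of coins fixed by [g] has equal blocks at [g^-1] and 1. *)
Lemma coin_shift_free g w : coin_shift g w = w ->
  forall i, w (g^-1%g, i) = w (1%g, i).
Proof.
by move=> gw i; rewrite -[in RHS]gw /coin_shift /= mulg1.
Qed.

End CoinAction.

Lemma product_action_mp (R : realType) d1 d2 (T1 : measurableType d1)
    (T2 : measurableType d2) (m1 : probability T1 R) (m2 : probability T2 R)
    (f1 : T1 -> T1) (f2 : T2 -> T2) :
  measurable_fun setT f1 -> measurable_fun setT f2 ->
  (forall A, measurable A -> m1 (f1 @^-1` A) = m1 A) ->
  (forall A, measurable A -> m2 (f2 @^-1` A) = m2 A) ->
  let f := fun xy : T1 * T2 => (f1 xy.1, f2 xy.2) in
  measurable_fun setT f /\
  forall A, measurable A -> (m1 \x m2)%E (f @^-1` A) = (m1 \x m2)%E A.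
Proof.
move=> mf1 mf2 mp1 mp2 f.
have mf : measurable_fun setT f.
  apply: measurable_fun_pair.
    exact: (measurableT_comp mf1 (@measurable_fst _ _ _ _)).
  exact: (measurableT_comp mf2 (@measurable_snd _ _ _ _)).
split=> // A mA; rewrite -[LHS]/(image_measure (m1 \x m2)%E mf A).
apply/esym/product_measure_unique => // B C mB mC.
rewrite -[LHS]/((m1 \x m2)%E (f @^-1` (B `*` C))).
rewrite (_ : f @^-1` _ = (f1 @^-1` B) `*` (f2 @^-1` C)) //.
have mfB : measurable (f1 @^-1` B) by rewrite -[X in measurable X]setTI; exact: mf1.
have mfC : measurable (f2 @^-1` C) by rewrite -[X in measurable X]setTI; exact: mf2.
by rewrite product_measure1E //; congr (_ * _)%E; [exact: mp1|exact: mp2].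
Qed.

(** * The complementary relation *)

Section Extension.
Variables (n k : nat) (ord : 'I_k -> nat) (G : groupType).
Variables (a : 'I_n -> G) (s : 'I_k -> G).
Hypothesis presG : has_presentation (cyclic_relators n ord) (sum_fun a s).
Local Notation F := (subgroup_gen (range a)).
Local Notation S := (subgroup_gen (range s)).
Variables (v t : G).
Hypotheses (Fv : F v) (v1 : v <> 1%g) (St : S t).
Local Notation V := (subgroup_gen [set v]).
Local Notation W := (subgroup_gen [set (v * t)%g]).

Variables (T X : Type) (act : G -> T -> T) (actX : G -> X -> X) (pi : T -> X).
Hypothesis act1 : forall y, act 1%g y = y.
Hypothesis actM : forall g h y, act (g * h)%g y = act g (act h y).
Hypothesis actXM : forall g h x, actX (g * h)%g x = actX g (actX h x).
Hypothesis piE : forall g y, pi (act g y) = actX g (pi y).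
Variable E' : set (X * X).
Hypothesis E'refl : forall x, E' (x, x).
Hypothesis E'sym : forall x y, E' (x, y) -> E' (y, x).
Hypothesis E'orb : E' `<=` orbit_rel actX F.
Hypothesis E'trans : forall x y z, E' (x, y) -> E' (y, z) -> E' (x, z).

Let sF : subgroup F := subgroup_genP _.
Let sS : subgroup S := subgroup_genP _.

(** The pull-back of [E'] along [pi], restricted to the orbits of F.  Nothing
    is required where F does not act freely on X: there the relation contains
    all pairs of an F-orbit lying in a common fibre of [pi]. *)
Definition lift_rel : set (T * T) :=
  [set yz | exists g, (F g /\ E' (pi yz.1, actX g (pi yz.1))) /\ act g yz.1 = yz.2].

Lemma lift_relP y g : F g -> E' (pi y, actX g (pi y)) -> lift_rel (y, act g y).
Proof. by move=> Fg Eg; exists g. Qed.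

Lemma lift_rel_sym y z : lift_rel (y, z) -> lift_rel (z, y).
Proof.
move=> [g [[/= Fg Eg] /= <-]].
rewrite -[X in lift_rel (_, X)](actK act1 actM g); apply: lift_relP.
  exact: (subgroupV sF).
by rewrite -piE (actK act1 actM) piE; exact: E'sym.
Qed.

Lemma lift_rel_trans x y z :
  lift_rel (x, y) -> lift_rel (y, z) -> lift_rel (x, z).
Proof.
move=> [g [[/= Fg Eg] /= <-]] [h [[/= Fh Eh] /= <-]].
rewrite -actM; apply: lift_relP; first exact: (subgroupM sF).
by apply: E'trans Eg _; rewrite actXM -piE.
Qed.

(** The complement of the orbit relation of [<v t>]: the join of the orbit
    relation of S and of [lift_rel]. *)
Definition complement_rel : set (T * T) :=
  chain_closure (orbit_rel act S `|` lift_rel).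

(** [E] contains the orbit relation of S and that of [v * t], hence that of
    [v].  For F, a chain in X from [pi y] to [g pi y] lifts to a chain from [y]
    to some [h y] in the same fibre as [g y], and [lift_rel] closes the gap. *)
Lemma complement_rel_generates (E : set (T * T)) :
  orbit_rel actX F `<=` chain_closure (orbit_rel actX V `|` E') ->
  (forall x, E (x, x)) -> (forall x y, E (x, y) -> E (y, x)) ->
  (forall x y z, E (x, y) -> E (y, z) -> E (x, z)) ->
  orbit_rel act W `|` complement_rel `<=` E ->
  orbit_rel act setT `<=` E.
Proof.
move=> genX Erefl Esym Etrans sub.
pose K := [set g | forall y, E (y, act g y)].
have sK : subgroup K.
  apply/subgroupP; split; first by move=> y; rewrite act1.
  move=> g h Kg Kh y; rewrite actM; apply: Etrans (Kg _).
  by apply: Esym; have := Kh (act h^-1%g y); rewrite (actVK act1 actM).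
have stepE y z : (orbit_rel act S `|` lift_rel) (y, z) -> E (y, z).
  by move=> h; apply: sub; right; exact: connected_step.
have KS g : S g -> K g by move=> Sg y; apply: stepE; left; exists g.
have KW : K (v * t)%g.
  by move=> y; apply: sub; left; exists (v * t)%g => //; exact: sub_subgroup_gen.
have Kv : K v.
  rewrite -[v](mulgK t); apply: (subgroupM sK) => //.
  by apply: (subgroupV sK); exact: KS.
have KV : V `<=` K by apply: subgroup_gen_min => // _ ->.
have VF : V `<=` F by apply: subgroup_gen_min => // _ ->.
have KF : F `<=` K.
  move=> g Fg y.
  have [m ch] : chain_closure (orbit_rel actX V `|` E') (pi y, actX g (pi y)).
    by apply: genX; exists g.
  suff [h [Fh Eh eh]] : exists h, [/\ F h, E (y, act h y) &
      actX h (pi y) = actX g (pi y)].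
    apply: Etrans Eh _; apply: stepE; right.
    have -> : act g y = act (g / h)%g (act h y) by rewrite -actM mulgVK.
    apply: lift_relP; first by apply: (subgroupM sF) => //; exact: (subgroupV sF).
    by rewrite -piE -actM mulgVK !piE eh.
  move: (actX g (pi y)) ch => x /=.
  have key x0 : chain (rel_of (orbit_rel actX V `|` E')) m x0 x ->
      forall z, pi z = x0 -> exists h, [/\ F h, E (z, act h z) & actX h (pi z) = x].
    elim: m x0 => [|m IH] x0 ch z ez; inversion ch as [|m' x' y' z' st ch']; subst.
      exists 1%g; rewrite act1; split=> //; first exact: subgroup1.
      by rewrite -piE act1.
    have [g0 [Fg0 e0 Eg0]] : exists g0, [/\ F g0, actX g0 (pi z) = y' &
        E (z, act g0 z)].
      case: st => [[g0 Vg0 /= e0]|Est].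
        by exists g0; split=> //; [exact: VF|exact: KV].
      have [g0 Fg0 /= e0] := E'orb Est.
      exists g0; split=> //; apply: stepE; right; apply: lift_relP => //.
      by rewrite e0.
    have [h [Fh Eh eh]] := IH _ ch' (act g0 z) (etrans (piE _ _) e0).
    exists (h * g0)%g; split; first exact: (subgroupM sF).
    - by rewrite actM; exact: Etrans Eh.
    - by rewrite actXM -piE.
  by move=> ch; exact: key ch y erefl.
by move=> [y z] [g _ /= <-]; apply: (generated_by_presentation presG sK) => i;
  [apply: KF|apply: KS]; apply: sub_subgroup_gen; exists i.
Qed.

Variables (B : set T) (B0 : set X).
Hypothesis Bact : forall g y, B y -> B (act g y).
Hypothesis Bfree : forall g y, B y -> act g y = y -> g = 1%g.
Hypothesis BB0 : forall y, B y -> B0 (pi y).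
Hypothesis Xfree : forall g y, F g -> B y -> actX g (pi y) = pi y -> g = 1%g.
Hypothesis orthX : orthogonal_rel (restrict_rel B0 (orbit_rel actX V))
                                  (restrict_rel B0 E').

(** The orbit relation of [H] restricted to [B]. *)
Definition orbit_in (H : set G) (x y : T) : Prop :=
  [/\ exists2 g, H g & act g x = y, B x & B y].

Lemma orbit_in_trans (H : set G) x y z : subgroup H ->
  orbit_in H x y -> orbit_in H y z -> orbit_in H x z.
Proof.
move=> sH [[g Hg <-] Bx _] [[h Hh <-] _ Bz]; split=> //.
by exists (h * g)%g; [exact: subgroupM|exact: actM].
Qed.

Lemma orbit_in_sym (H : set G) x y : subgroup H ->
  orbit_in H x y -> orbit_in H y x.
Proof.
move=> sH [[g Hg <-] Bx By]; split=> //; exists g^-1%g; first exact: subgroupV.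
exact: (actK act1 actM).
Qed.

(** [lift_rel] restricted to [B]. *)
Definition lift_in (x y : T) : Prop := [/\ lift_rel (x, y), B x & B y].

Lemma lift_in_trans x y z : lift_in x y -> lift_in y z -> lift_in x z.
Proof. by move=> [h1 Bx _] [h2 _ Bz]; split=> //; exact: lift_rel_trans h2. Qed.

Let VF : V `<=` F.
Proof. by apply: subgroup_gen_min => // _ ->. Qed.

(** As F acts freely on the projection of [B], the map [pi] does not collapse
    any step, and freeness is inherited from X. *)
Lemma rfree_lift : rfree (rel_pair (orbit_in V) lift_in).
Proof.
have : rfree (rel_pair (rel_of (restrict_rel B0 (orbit_rel actX V)))
                       (rel_of (restrict_rel B0 E'))).
  apply: orthogonal_rfree orthX.
    move=> x y z [[g Vg /= <-] [/= B0x _]] [[h Vh /= <-] [/= _ B0z]].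
    split; last by split.
    by exists (h * g)%g; [exact: (subgroupM (subgroup_genP _))|exact: actXM].
  move=> x y z [Exy [/= B0x _]] [Eyz [/= _ B0z]].
  by split; [exact: E'trans Eyz|split].
apply: (rfree_map (f := pi)) => -[] x y /=.
  move=> [[g Vg <-] Bx Bgx] nxy; split.
    split; first by exists g => //=; rewrite piE.
    by split; exact: BB0.
  rewrite piE => /esym/(Xfree (VF Vg) Bx) g1; apply: nxy.
  by rewrite g1 act1.
move=> [[g [[/= Fg Eg] /= <-]] Bx Bgx] nxy; split.
  by rewrite /rel_of piE; split=> //; split=> /=; rewrite -?piE; exact: BB0.
rewrite piE => /esym/(Xfree Fg Bx) g1; apply: nxy.
by rewrite g1 act1.
Qed.

(** The two uses of associativity: first with the orbit relation of F
    containing [lift_in] and the orbits of [<v>], then with the join J of the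
    orbits of [<v>] and S containing the orbits of [<v t>] and S. *)
Lemma rfree_complement : rfree (rel_pair (orbit_in W)
  (connected_by (fun x y => orbit_in S x y \/ lift_in x y))).
Proof.
have trF := fun x y z => @orbit_in_trans _ x y z sF.
have trS := fun x y z => @orbit_in_trans _ x y z sS.
have trV := fun x y z => @orbit_in_trans _ x y z (subgroup_genP [set v]).
have trW := fun x y z => @orbit_in_trans _ x y z (subgroup_genP [set (v * t)%g]).
have freeFS : rfree (rel_pair (orbit_in F) (orbit_in S)).
  apply: rfree_sub (free_pair_orbit act1 actM (fun g y => @Bfree g y) (free_pair_factor presG)).
  by case.
have freeWS : rfree (rel_pair (orbit_in W) (orbit_in S)).
  apply: rfree_sub (free_pair_orbit act1 actM (fun g y => @Bfree g y)
    (free_pair_twist presG Fv v1 St)).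
  by case.
pose J x y := connected_by (fun x y => orbit_in V x y \/ orbit_in S x y) x y.
have freeJ : rfree (rel_pair lift_in J).
  apply: (rfree_assoc (R12 := orbit_in F)) => //.
  - by move=> x y [[g [[/= Fg _] /= e]] Bx By]; split=> //; exists g.
  - by move=> x y [[g /VF Fg e] Bx By]; split=> //; exists g.
  - exact: lift_in_trans.
  - exact: rfree_pairC rfree_lift.
have WJ x y : orbit_in W x y -> J x y.
  have Jsym : forall x y, J x y -> J y x.
    by apply: connected_sym => ? ? [h|h]; [left|right]; apply: orbit_in_sym => //;
      exact: subgroup_genP.
  pose K := [set g | forall z, B z -> J z (act g z)].
  suff WK : W `<=` K by move=> [[g /WK Kg <-] Bx _]; exact: Kg.
  apply: subgroup_gen_min.
    apply/subgroupP; split; first by move=> z _; rewrite act1; exact: connected_refl.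
    move=> g h Kg Kh z Bz; rewrite actM; apply: connected_trans (Kg _ (Bact _ Bz)).
    by apply: Jsym; have := Kh _ (Bact h^-1%g Bz); rewrite (actVK act1 actM).
  move=> _ -> z Bz; rewrite actM.
  apply: (@connected_trans _ _ _ (act t z)); apply: connected_step.
    by right; split=> //; [exists t|exact: Bact].
  by left; split; [exists v => //; exact: sub_subgroup_gen|exact: Bact|do 2! apply: Bact].
apply: (rfree_assoc (R12 := J)) => //.
- by move=> x y h; apply: connected_step; right.
- exact: lift_in_trans.
- exact: connected_trans.
- exact: rfree_pairC.
Qed.

Lemma orthogonal_complement :
  orthogonal_rel (restrict_rel B (orbit_rel act W))
                 (restrict_rel B complement_rel).
Proof.
apply: rfree_orthogonal; apply: rfree_sub rfree_complement.
case=> x y; first by move=> [[g Wg /= e] [/= Bx By]]; split=> //; exists g.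
move=> [[m /= ch] [/= Bx _]]; elim: ch Bx => {m x y} [x|m x y z Exy _ IH] Bx.
  exact: connected_refl.
have By : B y by case: Exy => [[g _ /= <-]|[g [_ /= <-]]]; exact: Bact.
apply: connected_trans (IH By); apply: connected_step.
by case: Exy => [[g Sg /= e]|L]; [left|right]; split=> //; exists g.
Qed.

End Extension.

(** * The measure free factor generated by v t *)

Theorem theorem6p1 (R : realType) (n k : nat) (ord : 'I_k -> nat)
    (ord_gt0 : forall j, (0 < ord j)%N)
    (G : groupType) (a : 'I_n -> G) (s : 'I_k -> G)
    (presG : has_presentation (cyclic_relators n ord) (sum_fun a s))
    (v : G) (v_in_Fn : subgroup_gen (range a) v) (v_neq1 : v <> 1%g)
    (mff_v : measure_free_factor R
               (subgroup_gen (range a)) (subgroup_gen [set v]))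
    (p : 'I_k -> int) :
  measure_free_factor R [set: G]
    (subgroup_gen [set (v * \prod_(j < k) zexpg (s j) (p j))%g]).
Proof.
have [_ _ HF [d [X [mu [act0 [E' [sbX pmp0 free0 borelE' fprod]]]]]]] := mff_v.
have [_ _ _ [_ subE minE] [B0 [mB0 B01 orth0]]] := fprod.
have [enum enumE] := presentation_enum presG.
have [e e_inj] := presentation_code presG.
have [actX [actX1 actXM actXE mactX mpX]] := extend_action presG pmp0.
set F := subgroup_gen (range a) in HF pmp0 free0 fprod subE minE actXE.
have sT : subgroup [set: G] by apply/subgroupP.
have sF : subgroup F := subgroup_genP _.
set t := (\prod_(j < k) zexpg (s j) (p j))%g.
have St : subgroup_gen (range s) t.
  have sS : subgroup (subgroup_gen (range s)) := subgroup_genP _.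
  apply: (@subgroup_prod _ _ _ _ _ sS) => j.
  have Sj : subgroup_gen (range s) (s j) by apply: sub_subgroup_gen; exists j.
  case: (p j) => m; rewrite /zexpg; first exact: (subgroupX _ sS).
  by apply: (subgroupV sS); exact: (subgroupX _ sS).
have orbE H : H `<=` F -> orbit_rel act0 H = orbit_rel actX H.
  move=> HsubF; apply/seteqP.
  by split=> -[x y] [g Hg /= <-]; exists g => //=; rewrite actXE //; exact: HsubF.
have eF : orbit_rel act0 F = orbit_rel actX F by exact: orbE.
have eV : orbit_rel act0 (subgroup_gen [set v]) =
  orbit_rel actX (subgroup_gen [set v]) by exact: orbE.
rewrite eF eV in subE minE; rewrite eV in orth0.
have mdiagX := measurable_diagonal sbX.
have [mE' E'refl E'sym E'trans] := borelE'.
have E'orb : E' `<=` orbit_rel actX F by move=> xy Exy; apply: subE; right.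
have orbT H : orbit_rel actX H `<=` orbit_rel actX setT.
  by move=> xy [g _ h]; exists g.
(* The diagonal action on X times the coin space. *)
pose T := (X * coins (G * nat)%type)%type.
pose nu : probability T R := (mu \x coin_measure R e)%E.
pose act g (y : T) : T := (actX g y.1, coin_shift g y.2).
have act1 y : act 1%g y = y.
  by rewrite /act actX1 coin_shift1; case: y.
have actM g h y : act (g * h)%g y = act g (act h y).
  by rewrite /act actXM coin_shiftM.
have actP g : measurable_fun setT (act g) /\
    forall A, measurable A -> nu (act g @^-1` A) = nu A.
  apply: product_action_mp => //; first exact: measurable_coin_shift.
    exact: mpX.
  by move=> A mA; exact: coin_shift_mp.
have mact g := (actP g).1; have mpact g := (actP g).2.
have sbT : standard_borel R T := standard_borel_prod_coins e_inj sbX.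
have mdiag := measurable_diagonal sbT.
(* The null set of coin sequences that some nontrivial shift may fix. *)
pose NW : set (coins (G * nat)%type) :=
  \bigcup_m [set w | enum m <> 1%g /\ forall i, w ((enum m)^-1%g, i) = w (1%g, i)].
have NWm m : measurable ([set w | enum m <> 1%g /\
      forall i, w ((enum m)^-1%g, i) = w (1%g, i)] : set (coins (G * nat)%type)) /\
    coin_measure R e [set w | enum m <> 1%g /\
      forall i, w ((enum m)^-1%g, i) = w (1%g, i)] = 0%E.
  have [e1|ne1] := pselect (enum m = 1%g).
    by rewrite (_ : [set _ | _] = set0) ?measure0 //; apply/seteqP; split=> // w [].
  rewrite (_ : [set _ | _] = [set w | forall i, w ((enum m)^-1%g, i) = w (1%g, i)]).
    by apply: coin_shift_fix_null => // /eqP; rewrite invg_eq1 => /eqP.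
  by apply/seteqP; split=> w // [].
have mNW : measurable NW by apply: bigcup_measurable => m _; exact: (NWm m).1.
have NW0 : coin_measure R e NW = 0%E.
  apply: measure_negligible => //; apply: negligible_bigcup => m.
  by apply/negligibleP; [exact: (NWm m).1|exact: (NWm m).2].
have NWP g w : g <> 1%g -> coin_shift g w = w -> NW w.
  move=> g1 gw; have [m em] := enumE g.
  by exists m => //; rewrite /= em; split=> //; exact: coin_shift_free gw.
have [NX [mNX NX0 NXP]] := free0.
(* Outside Bad, the point of X lies in B0, F acts freely at it, and the shift
   is free at the coins. *)
pose Bad : set T := ((~` B0 `|` NX) `*` setT) `|` (setT `*` NW).
have mBad : measurable Bad.
  apply: measurableU; apply: measurableX => //.
  by apply: measurableU => //; exact: measurableC.
have nuT : nu (setT `*` NW) = 0%E.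
  transitivity (mu setT * coin_measure R e NW)%E; first exact: product_measure1E.
  by rewrite NW0 mule0.
have Bad0 : nu Bad = 0%E.
  have mN : measurable (~` B0 `|` NX).
    by apply: measurableU => //; exact: measurableC.
  have N0 : mu (~` B0 `|` NX) = 0%E.
    apply: measure_negligible => //; apply: negligibleU; apply/negligibleP => //.
      exact: measurableC.
    transitivity (1 - mu B0)%E; first exact: probability_setC.
    by rewrite B01 subee.
  apply: measure_negligible => //; apply: negligibleU.
    apply/negligibleP; first exact: measurableX.
    transitivity (mu (~` B0 `|` NX) * coin_measure R e setT)%E.
      exact: product_measure1E.
    by rewrite N0 mul0e.
  by apply/negligibleP => //; exact: measurableX.
(* The invariant conull set on which orthogonality is checked. *)
pose B := [set y : T | forall g, ~ Bad (act g y)].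
have [mB B1] := conull_invariant enumE mact mpact mBad Bad0.
have nBad y : B y -> ~ Bad y by move=> /(_ 1%g); rewrite act1.
have Bact g y : B y -> B (act g y).
  by move=> By h; rewrite -actM; exact: By.
have Bfree g y : B y -> act g y = y -> g = 1%g.
  move=> /nBad nb gy; apply: contrapT => g1; apply: nb; right; split=> //.
  by apply: (NWP g) => //; rewrite -[RHS](congr1 snd gy).
have BB0 y : B y -> B0 y.1.
  by move=> /nBad nb; apply: contrapT => h; apply: nb; left; split=> //; left.
have Xfree g y : F g -> B y -> actX g y.1 = y.1 -> g = 1%g.
  move=> Fg /nBad nb gy; apply: contrapT => g1; apply: nb; left; split=> //.
  by right; apply: NXP; exists g; split=> //; rewrite -actXE.
have piE g (y : T) : (act g y).1 = actX g y.1 by [].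
pose L := lift_rel a act actX fst E'.
have mL : measurable L.
  apply: (measurable_orbit_pairs enumE mact mdiag (P := fun g =>
    [set yz : T * T | F g /\ E' (yz.1.1, actX g yz.1.1)])) => g.
  have [Fg|nFg] := pselect (F g); last first.
    suff -> : [set yz : T * T | F g /\ E' (yz.1.1, actX g yz.1.1)] = set0.
      exact: measurable0.
    by apply/seteqP; split=> // yz [].
  have m11 : measurable_fun setT (fun yz : T * T => yz.1.1).
    exact: (measurableT_comp (@measurable_fst _ _ _ _) (@measurable_fst _ _ _ _)).
  have mf : measurable_fun setT (fun yz : T * T => (yz.1.1, actX g yz.1.1)).
    by apply: measurable_fun_pair => //; exact: (measurableT_comp (mactX g) m11).
  have := mf measurableT _ mE'; rewrite setTI; congr measurable.
  by apply/seteqP; split=> // yz [].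
have Lsym y z : L (y, z) -> L (z, y).
  exact: lift_rel_sym.
have Lorb : L `<=` orbit_rel act setT by move=> yz [g [_ h]]; exists g.
set W := subgroup_gen [set (v * t)%g].
have sW : subgroup W := subgroup_genP _.
pose C := complement_rel a s act actX fst E'.
have Corb : orbit_rel act (subgroup_gen (range s)) `|` L `<=` orbit_rel act setT.
  by move=> yz [[g _ h]|]; [exists g|exact: Lorb].
have bC : borel_equivalence C.
  have bS := borel_orbit_rel enumE mact mdiag act1 actM (subgroup_genP (range s)).
  have [mS _ Ssym _] := bS.
  apply: (borel_chain_closure enumE mact) => //; first exact: measurableU.
  by move=> y z [/Ssym|/Lsym]; [left|right].
have genX : orbit_rel actX F `<=`
    chain_closure (orbit_rel actX (subgroup_gen [set v]) `|` E').
  have [mV _ Vsym _] :=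
    borel_orbit_rel enumE mactX mdiagX actX1 actXM (subgroup_genP [set v]).
  apply: minE; last by move=> -[x y] h; exact: connected_step.
  apply: (borel_chain_closure enumE mactX) => //; first exact: measurableU.
    by move=> xy [/orbT|/E'orb/orbT].
  by move=> x y [/Vsym|/E'sym]; [left|right].
split; first by apply/subgroupP.
- exact: sW.
- by [].
exists _, T, nu, act, C; split=> //.
- split=> // g _; exact: (mp_borel_iso_act mact act1 actM _ mpact).
- exists (setT `*` NW); split.
  + exact: measurableX.
  + exact: nuT.
  + by move=> y [g [_ g1 gy]]; split=> //; apply: (NWP g) => //; rewrite -[RHS](congr1 snd gy).
split=> //.
- exact: (mp_equivalence_orbit_rel enumE mact mdiag act1 actM mpact).
- exact: borel_orbit_rel.
- split.
  + by apply: borel_orbit_rel => //; apply/subgroupP.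
  + move=> yz [[g _ h]|]; first by exists g.
    have [_ r1 _ t1] := borel_orbit_rel enumE mact mdiag act1 actM
      sT.
    case: yz => y z; apply: (connected_min (E' := rel_of (orbit_rel act setT))) => //.
    by move=> x x' h; exact: Corb.
  + move=> E0 [_ E0r E0s E0t] sub.
    exact: (complement_rel_generates presG v_in_Fn St act1 actM actXM piE
      E'refl E'orb genX E0r E0s E0t sub).
exists B; split=> //.
exact: (orthogonal_complement presG v_in_Fn v_neq1 St act1 actM actXM piE
  E'trans Bact Bfree BB0 Xfree orth0).
Qed.
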